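(* Let $1<p<\infty$. Let $(X,d,\mu)$ be an unbounded complete metric measure space with $\mu$ a doubling measure and supporting a $p$-Poincaré inequality. Let $\Omega\subset X$ be an unbounded uniform domain with $X=\overline{\Omega}^d$ (the metric completion of $(\Omega,d)$), whose boundary $\partial\Omega=X\setminus\Omega$ is unbounded, uniformly perfect, and equipped with a Radon measure $\nu$ that is $\theta$-codimensional with respect to $\mu$ for some $0<\theta<p$. Fix $b\in\partial\Omega$. Then $(\overline{\Omega}^d,d,\mu)$ is $p$-parabolic if \[\liminf_{R\to\infty}\frac{\mu(B(b,R))}{R^p}<\infty,\] and $(\overline{\Omega}^d,d,\mu)$ is $p$-hyperbolic if there is some $q_0>p$ such that \[\liminf_{R\to\infty}\frac{\mu(B(b,R))}{R^{q_0}}>0.\]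
   Context: Balls $B(x,r)$ are open, $r>0$; for $B=B(x,r)$ and $k>0$, $kB=B(x,kr)$. A Borel measure $\mu$ is doubling if there is $C_\mu\ge1$ with $0<\mu(B(x,2r))\le C_\mu\mu(B(x,r))<\infty$ for all $x$ and $r>0$. $p$-Poincaré inequality: there are $C_P>0$, $\lambda\ge1$ such that for every ball $B=B(x,r)$, measurable $u$, and upper gradient $g$ of $u$, $\frac{1}{\mu(B)}\int_B|u-u_B|\,d\mu\le C_Pr\left(\frac1{\mu(\lambda B)}\int_{\lambda B}g^p\,d\mu\right)^{1/p}$, where $u_B$ is the $\mu$-average. A nonnegative Borel $g$ is an upper gradient of $u$ if $|u(x)-u(y)|\le\int_\gamma g\,ds$ for every nonconstant rectifiable curve $\gamma$ with end points $x,y$ (the right side being $\infty$ if $u(x)$ or $u(y)$ is not real). Uniform domain: $\Omega$ is locally compact, not complete, and there is $C_U\ge1$ such that every pair $x,y\in\Omega$ is joined by a rectifiable curve $\gamma\subset\Omega$ with length $\ell(\gamma)\le C_Ud(x,y)$ and $\min\{\ell(\gamma_{[x,z]}),\ell(\gamma_{[z,y]})\}\le C_U\operatorname{dist}(z,X\setminus\Omega)$ for all $z\in\gamma$, where $\gamma_{[x,z]}$ denotes a subarc of $\gamma$ between $x$ and $z$. Uniformly perfect: a set $A$ is uniformly perfect if there is $\kappa>1$ such that for every $a\in A$ and $r>0$ with $A\cap B(a,r)\ne A$ one has $(B(a,\kappa r)\setminus B(a,r))\cap A\neq\varnothing$. $\theta$-codimensional: there is $C_\theta\ge1$ with $C_\theta^{-1}r^{-\theta}\mu(B(x,r))\le\nu(B(x,r))\le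 C_\theta r^{-\theta}\mu(B(x,r))$ for all $x\in\partial\Omega$ and $0<r<2\operatorname{diam}(\partial\Omega)$. $p$-modulus: $\mathrm{Mod}_p(\Gamma)=\inf\int g^p\,d\mu$ over nonnegative Borel $g$ with $\int_\gamma g\,ds\ge1$ for all locally rectifiable $\gamma\in\Gamma$. $p$-hyperbolic: a metric measure space $Y$ is $p$-hyperbolic if there is a ball $B\subset Y$ such that $\mathrm{Mod}_p(\Gamma(\infty))>0$, where $\Gamma(\infty)$ is the collection of all locally rectifiable curves $\gamma:[0,\infty)\to Y$ with $\gamma(0)\in\overline B$ such that for each $n\in\mathbb N$ there is $t_n>0$ with $\gamma([t_n,\infty))\subset Y\setminus nB$. It is $p$-parabolic if it is not $p$-hyperbolic. *)

(* Defs.v *)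
From HB Require Import structures.
From mathcomp Require Import all_boot all_order all_algebra.
From mathcomp Require Import all_classical all_reals all_analysis.
From mathcomp Require Import measurable_realfun.

Set Implicit Arguments.
Unset Strict Implicit.
Unset Printing Implicit Defensive.

Import Order.TTheory GRing.Theory Num.Def Num.Theory.
Import numFieldNormedType.Exports.

Local Open Scope classical_set_scope.
Local Open Scope ring_scope.

(* [measurableType] requires a pointed carrier, so nonempty metric spaces carry
   a point; nothing below depends on which one it is. *)
#[short(type="pmetricType")]
HB.structure Definition PMetric (R : numDomainType) :=
  { M of Metric R M & Pointed M }.

Definition borel (R : realType) (X : pmetricType R) :=
  g_sigma_algebraType (@open X).

Definition complete_space (U : uniformType) :=
  forall F : set_system U, ProperFilter F -> cauchy F -> exists x : U, F --> x.

Section metric.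
Context {R : realType} {X : pmetricType R}.
Implicit Types (A : set X) (gamma : R -> X) (I : interval R).

Definition diameter A : \bar R :=
  ereal_sup [set (mdist xy.1 xy.2)%:E | xy in A `*` A].

Definition unbounded A := diameter A = +oo%E.

Definition uniformly_perfect A := exists2 kappa : R, 1 < kappa &
  forall (a : X) (r : R), A a -> 0 < r -> A `&` ball a r <> A ->
    (ball a (kappa * r) `\` ball a r) `&` A !=set0.

(* A curve is a function [gamma : R -> X] together with an interval, outside of
   which its values are irrelevant. *)
Definition curve_length gamma (a b : R) : \bar R :=
  ereal_sup [set (\sum_(0 <= k < size s)
      mdist (gamma (nth b (a :: s) k)) (gamma (nth b (a :: s) k.+1)))%:E
    | s in itv_partition a b].

Definition rectifiable gamma (a b : R) :=
  [/\ a <= b, {within `[a, b], continuous gamma}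
    & (curve_length gamma a b < +oo)%E].

Definition locally_rectifiable I gamma :=
  {within [set` I], continuous gamma} /\
  forall a b : R, a \in I -> b \in I -> a <= b -> rectifiable gamma a b.

(* [gamma t] is the same for every [t] in [[a, b]] such that the restriction of
   [gamma] to [[a, t]] has length [s]. *)
Definition arclength_param gamma (a b s : R) : X :=
  gamma (xget a [set t | a <= t <= b /\ curve_length gamma a t = s%:E]).

Definition line_integral (g : X -> \bar R) gamma (a b : R) : \bar R :=
  (\int[lebesgue_measure]_(s in `[0%R, fine (curve_length gamma a b)])
     g (arclength_param gamma a b s))%E.

Definition curve_integral (g : X -> \bar R) I gamma : \bar R :=
  ereal_sup [set line_integral g gamma ab.1 ab.2 | ab in
    [set ab : R * R | [/\ ab.1 \in I, ab.2 \in I & ab.1 <= ab.2]]].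

Definition nonneg_borel (g : X -> \bar R) :=
  (forall x, 0 <= g x)%E /\ measurable_fun setT (g : borel X -> \bar R).

(* In [\bar R], +oo - +oo = -oo, so [`|u x - u y|] is +oo as soon as [u x] or
   [u y] is not real. *)
Definition upper_gradient (u g : X -> \bar R) :=
  nonneg_borel g /\
  forall gamma (a b : R), rectifiable gamma a b ->
    (exists2 t, a <= t <= b & gamma t <> gamma a) ->
    (`|u (gamma a) - u (gamma b)| <= line_integral g gamma a b)%E.

(* [locally_compact Omega] would ask for closed compact neighborhoods in the
   ambient space; local compactness and completeness of [Omega] are instead
   those of the subtype with the induced structure. *)
Definition uniform_domain (Omega : set X) :=
  [/\ locally_compact [set: Omega],
      ~ complete_space Omega &
      exists2 C : R, 1 <= C & forall x y : X, Omega x -> Omega y ->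
        exists gamma, exists a b : R,
          [/\ rectifiable gamma a b,
              gamma a = x /\ gamma b = y,
              gamma @` `[a, b] `<=` Omega,
              (curve_length gamma a b <= (C * mdist x y)%:E)%E &
              forall t : R, a <= t <= b ->
                (mine (curve_length gamma a t) (curve_length gamma t b)
                  <= C%:E * edist_inf (~` Omega) (gamma t))%E]].

End metric.

Section metric_measure.
Context {R : realType} {X : pmetricType R}.
Implicit Types (mu nu : {measure set (borel X) -> \bar R}).
Local Open Scope ereal_scope.

Definition doubling mu := exists2 C : R, (1 <= C)%R &
  forall (x : X) (r : R), (0 < r)%R ->
    [/\ 0 < mu (ball x (2 * r)%R),
        mu (ball x (2 * r)%R) <= C%:E * mu (ball x r) &
        C%:E * mu (ball x r) < +oo].

(* Measurability with respect to the completion of [mu]. *)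
Definition mu_measurable mu (u : X -> \bar R) :=
  exists2 v : borel X -> \bar R, measurable_fun setT v &
    {ae mu, forall x, u x = v x}.

Definition average mu (f : X -> \bar R) (A : set X) : \bar R :=
  (fine (mu A))^-1%:E * \int[mu]_(x in A) f x.

(* If [u] has no average over the ball, because the integrals of its positive
   and negative parts are both infinite, then [average mu u (ball x r)] is -oo
   and the left-hand side is +oo. *)
Definition poincare mu (p : R) := exists C lambda : R,
  [/\ (0 < C)%R, (1 <= lambda)%R &
  forall (x : X) (r : R) (u g : X -> \bar R), (0 < r)%R ->
    mu_measurable mu u -> upper_gradient u g ->
    average mu (fun y => `|u y - average mu u (ball x r)|) (ball x r) <=
    (C * r)%:E *
      (average mu (fun y => g y `^ p) (ball x (lambda * r)%R)) `^ p^-1].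

Definition radon nu :=
  [/\ forall K : set X, compact K -> nu K < +oo,
      forall A : set (borel X), measurable A ->
        nu A = ereal_inf [set nu U | U in [set U : set X | open U /\ A `<=` U]] &
      forall U : set X, open U ->
        nu U = ereal_sup [set nu K | K in [set K : set X | compact K /\ K `<=` U]]].

(* A Radon measure on a closed set [S] is a Radon measure on the whole space
   for which the complement of [S] is null. *)
Definition radon_on (S : set X) nu := radon nu /\ nu (~` S) = 0.

Definition codimensional mu nu (S : set X) (theta : R) :=
  exists2 C : R, (1 <= C)%R & forall (x : X) (r : R), S x -> (0 < r)%R ->
    r%:E < 2%:E * diameter S ->
    (C^-1 * r `^ (- theta))%:E * mu (ball x r) <= nu (ball x r) /\
    nu (ball x r) <= (C * r `^ (- theta))%:E * mu (ball x r).

Definition admissible (Gamma : set (interval R * (R -> X))) : set (X -> \bar R) :=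
  [set g | nonneg_borel g /\
     forall I gamma, Gamma (I, gamma) -> locally_rectifiable I gamma ->
       1 <= curve_integral g I gamma].

Definition modulus mu (p : R) (Gamma : set (interval R * (R -> X))) : \bar R :=
  ereal_inf [set \int[mu]_x (g x `^ p) | g in admissible Gamma].

Definition curves_to_infinity (x : X) (r : R) : set (interval R * (R -> X)) :=
  [set c | [/\ c.1 = `[0%R, +oo[%R,
               locally_rectifiable c.1 c.2,
               closure (ball x r) (c.2 0%R) &
               forall n : nat, exists2 t : R, (0 < t)%R &
                 forall s, (t <= s)%R -> ~ ball x (n%:R * r)%R (c.2 s)]].

Definition hyperbolic mu (p : R) := exists (x : X) (r : R),
  (0 < r)%R /\ 0 < modulus mu p (curves_to_infinity x r).

Definition parabolic mu (p : R) := ~ hyperbolic mu p.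

Definition liminf_growth mu (b : X) (q : R) : \bar R :=
  limf_einf (fun r : R => mu (ball b r) * ((r `^ q)^-1)%:E) (pinfty_nbhs R).

End metric_measure.

(* Main.v *)
Require Import Defs.
From mathcomp Require Import all_boot all_order all_algebra.
From mathcomp Require Import all_classical all_reals all_analysis.
From mathcomp Require Import measurable_realfun.
From mathcomp Require Import ring lra.

Set Implicit Arguments.
Unset Strict Implicit.
Unset Printing Implicit Defensive.

Import Order.TTheory GRing.Theory Num.Def Num.Theory.
Import numFieldNormedType.Exports.

Local Open Scope classical_set_scope.
Local Open Scope ring_scope.

(** Parabolicity.  Slow growth provides arbitrarily large radii [r] such that
    the volume of [ball b r] is at most [M * r `^ p].  Choose [N + 1] such radii,
    each much larger than the one before, and the weight that spends an equal
    share of the required unit of length on an annulus at each of them.  Up to a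
    constant, an annulus contributes [(N * r) `^ (- p)] times the volume of the
    ball, so the energy is of order [N `^ (1 - p)].  Every curve that goes to
    infinity crosses the annuli that lie far enough from its starting ball, and
    [p > 1]; hence the modulus is zero ([parabolic_of_slow_growth]).

    Hyperbolicity.  Under fast growth, a weight [g] of small energy is not
    admissible for the ball [ball b r0], where [r0] is a radius from which the
    growth condition holds.

    - The weight [g] is first replaced by an increasing sequence of Lipschitz
      functions [h m] whose supremum is at least [g], whose energies are barely
      larger than that of [g], and which, but for [h 0], are bounded away from
      zero on bounded sets ([vitali_caratheodory], [lipschitz_minorants]).

    - Let [u k x] be the least cost with respect to [h k], cut at 1, of a chain
      of small steps from [x] to the outside of [ball b k.+1].  Working with
      chains instead of curves makes [u k] continuous, hence Borel, and
      [h k] is an upper gradient of [u k] because it is Lipschitz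
      ([local_upper_gradient]).  By the Poincare inequality, the means of [u k]
      over two consecutive balls of radii [2 ^+ j * r0] differ by at most
      a multiple of the radius times the [p]-th root of energy over volume.  As
      the volume grows faster than the [p]-th power of the radius, the sum of
      these errors is a convergent geometric series; since the means tend to
      zero, the mean of [u k] over [ball b r0] is small uniformly in [k]
      ([mean_le_energy]).  So for every [k] some chain from [ball b r0] to the
      outside of [ball b k.+1] costs less than one half.

    - These chains, walked at unit speed, converge along an ultrafilter to a
      1-Lipschitz curve, bounded sets being relatively compact in a complete
      doubling space.  The limit [c] of their costs dominates the integral of
      every [h m] along that curve ([limit_curve]).  Because [h 1] has a
      positive lower bound on each ball and [c] is bounded, the curve leaves
      every ball for good ([escape]); moreover the line integral of [g] along
      it is at most one half ([limit_curve_integral]). *)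

(** * Length of curves *)

Section curve_length.
Context {R : realType} {X : pmetricType R}.
Implicit Types (gamma : R -> X) (a b c t : R) (s : seq R).

(** Recursive form of the sums in [curve_length], for inductions along a
    partition. *)
Fixpoint polylen gamma a s : R :=
  if s is x :: s' then mdist (gamma a) (gamma x) + polylen gamma x s' else 0.

Lemma polylen_cat gamma a s1 s2 :
  polylen gamma a (s1 ++ s2) = polylen gamma a s1 + polylen gamma (last a s1) s2.
Proof. by elim: s1 a => [|x s IH] a /=; rewrite ?add0r// IH addrA. Qed.

Lemma polylenE gamma b a s : polylen gamma a s =
  \sum_(0 <= k < size s)
      mdist (gamma (nth b (a :: s) k)) (gamma (nth b (a :: s) k.+1)).
Proof.
elim: s a => [|x s IH] a /=; first by rewrite big_nil.
by rewrite big_nat_recl//= IH.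
Qed.

Lemma curve_lengthE gamma a b : curve_length gamma a b =
  ereal_sup [set (polylen gamma a s)%:E | s in itv_partition a b].
Proof.
by congr ereal_sup; apply/seteqP; split => _ [s /= ss <-]; exists s => //;
  rewrite (polylenE _ b).
Qed.

Lemma polylen_le_length gamma a b s : itv_partition a b s ->
  ((polylen gamma a s)%:E <= curve_length gamma a b)%E.
Proof. by move=> ss; rewrite curve_lengthE; apply: ereal_sup_ubound; exists s. Qed.

Lemma length_le gamma a b M :
  (forall s, itv_partition a b s -> (polylen gamma a s)%:E <= M)%E ->
  (curve_length gamma a b <= M)%E.
Proof.
move=> H; rewrite curve_lengthE; apply: ge_ereal_sup => _ [s ss <-].
exact: H.
Qed.

Lemma curve_lengthxx gamma a : curve_length gamma a a = 0%E.
Proof.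
apply/eqP; rewrite eq_le; apply/andP; split.
  by apply: length_le => s /itv_partitionxx ->.
by apply: (@polylen_le_length _ _ _ [::]).
Qed.

Lemma mdist_le_length gamma a b : a <= b ->
  ((mdist (gamma a) (gamma b))%:E <= curve_length gamma a b)%E.
Proof.
rewrite le_eqVlt => /orP[/eqP->|ab]; first by rewrite curve_lengthxx mdistxx.
have := @polylen_le_length gamma _ _ _ (itv_partition1 ab).
by rewrite /= addr0.
Qed.

Lemma curve_length_ge0 gamma a b : a <= b -> (0 <= curve_length gamma a b)%E.
Proof.
move=> ab; apply: le_trans (mdist_le_length gamma ab).
by rewrite lee_fin mdist_ge0.
Qed.

Lemma length_superadd gamma a b c : a <= b -> b <= c ->
  (curve_length gamma a b + curve_length gamma b c <= curve_length gamma a c)%E.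
Proof.
move=> ab bc.
have key s1 : itv_partition a b s1 ->
  ((polylen gamma a s1)%:E + curve_length gamma b c <= curve_length gamma a c)%E.
  move=> p1; rewrite addeC -leeBrDr//; apply: length_le => s2 p2.
  rewrite leeBrDr// -EFinD.
  have := polylen_le_length gamma (itv_partition_cat p1 p2).
  by rewrite polylen_cat addrC; case: p1 => _ /eqP ->.
have [Lbc|Lbc] := boolP (curve_length gamma b c \is a fin_num).
  rewrite -leeBrDr//; apply: length_le => s1 p1.
  by rewrite leeBrDr//; exact: key.
have Loo : curve_length gamma b c = +oo%E.
  by move: Lbc (curve_length_ge0 gamma bc); case: curve_length.
have := mdist_le_length gamma ab.
have [e1|ab'] := eqVneq a b.
  by rewrite -e1 curve_lengthxx add0e.
have ab2 : a < b by rewrite lt_neqAle ab' ab.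
have := key _ (itv_partition1 ab2).
rewrite Loo addey// leye_eq => /eqP -> _; exact: leey.
Qed.

(** When [b] falls inside a step of the partition, the triangle inequality allows
    cutting that step at [b]. *)
Lemma length_subadd gamma a b c : a <= b -> b <= c ->
  (curve_length gamma a c <= curve_length gamma a b + curve_length gamma b c)%E.
Proof.
move=> ab bc; apply: length_le => s; elim: s a ab => [|x s IH] a ab.
  move=> /itv_partition_nil e.
  have -> : a = b by apply/eqP; rewrite eq_le ab e bc.
  by rewrite curve_lengthxx add0e curve_length_ge0.
move=> ps; have psx := itv_partition_cons ps.
have ax : a < x by case: ps => /=/andP[].
rewrite /= EFinD; have [xb|bx] := leP x b.
  apply: le_trans (leeD2l _ (IH _ xb psx)) _.
  rewrite addeA; apply: leeD2r; apply: le_trans (length_superadd gamma (ltW ax) xb).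
  exact/leeD2r/mdist_le_length/ltW.
have xc := itv_partition_le psx.
apply: (@le_trans _ _ ((mdist (gamma a) (gamma b))%:E +
   ((mdist (gamma b) (gamma x))%:E + curve_length gamma x c))%E).
  rewrite addeA; apply: leeD; last exact: polylen_le_length.
  by rewrite -EFinD lee_fin metric_triangle.
apply: leeD; first exact: mdist_le_length.
apply: le_trans (length_superadd gamma (ltW bx) xc).
exact/leeD2r/mdist_le_length/ltW.
Qed.

Lemma curve_lengthD gamma a b c : a <= b -> b <= c ->
  curve_length gamma a c = (curve_length gamma a b + curve_length gamma b c)%E.
Proof.
by move=> ab bc; apply/eqP; rewrite eq_le length_subadd// length_superadd.
Qed.

Lemma lipschitz_length gamma a b : a <= b ->
  (forall t t', t <= t' -> mdist (gamma t) (gamma t') <= t' - t) ->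
  (curve_length gamma a b <= (b - a)%:E)%E.
Proof.
move=> ab H; apply: length_le => s; rewrite lee_fin.
elim: s a {ab} => [|x s IH] a ps /=.
  by rewrite (itv_partition_nil ps) subrr.
have ax : a < x by case: ps => /=/andP[].
by rewrite (le_trans (lerD (H _ _ (ltW ax)) (IH _ (itv_partition_cons ps))))//; lra.
Qed.

(** Cutting the last step of a partition at a later point does not decrease the
    sum, by the triangle inequality. *)
Lemma polylen_left gamma a c s : a < c -> itv_partition a c s ->
  exists2 t, a <= t < c & forall t', t <= t' < c ->
  ((polylen gamma a s)%:E <= curve_length gamma a t' +
     (mdist (gamma t') (gamma c))%:E)%E.
Proof.
elim: s a => [|x s IH] a ac.
  by move=> /itv_partition_nil e; rewrite e ltxx in ac.
move=> ps; have psx := itv_partition_cons ps.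
have ax : a < x by case: ps => /=/andP[].
have := itv_partition_le psx; rewrite le_eqVlt => /orP[/eqP xc|xc].
  move: psx; rewrite xc => /itv_partitionxx ->.
  exists a; first by rewrite lexx.
  move=> t' /andP[at' t'c]; rewrite /= addr0.
  apply: (@le_trans _ _ ((mdist (gamma a) (gamma t'))%:E +
    (mdist (gamma t') (gamma c))%:E)%E).
    by rewrite -EFinD lee_fin metric_triangle.
  exact/leeD2r/mdist_le_length.
have [t /andP[xt tc] Ht] := IH _ xc psx; exists t.
  by rewrite tc (le_trans (ltW ax)).
move=> t' /andP[tt' t'c]; rewrite /= EFinD.
have xt' := le_trans xt tt'.
have H : t <= t' < c by rewrite tt'.
apply: le_trans (leeD2l _ (Ht t' H)) _.
rewrite addeA leeD2r// (curve_lengthD gamma (ltW ax) xt') leeD2r//.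
exact/mdist_le_length/ltW.
Qed.

Lemma polylen_right gamma a c s : a < c -> itv_partition a c s ->
  exists2 t, a < t <= c & forall t', a < t' <= t ->
  ((polylen gamma a s)%:E <= (mdist (gamma a) (gamma t'))%:E +
     curve_length gamma t' c)%E.
Proof.
case: s => [|x s] ac.
  by move=> /itv_partition_nil e; rewrite e ltxx in ac.
move=> ps; have psx := itv_partition_cons ps.
have ax : a < x by case: ps => /=/andP[].
have xc := itv_partition_le psx.
exists x; first by rewrite ax.
move=> t' /andP[at' t'x]; rewrite (curve_lengthD gamma t'x xc) addeA /= EFinD.
apply: leeD; last exact: polylen_le_length.
apply: (@le_trans _ _ ((mdist (gamma a) (gamma t'))%:E +
    (mdist (gamma t') (gamma x))%:E)%E).
  by rewrite -EFinD lee_fin metric_triangle.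
exact/leeD2l/mdist_le_length.
Qed.

Definition arclen gamma a b := fine (curve_length gamma a b).

Section rectifiable.
Context (gamma : R -> X) (a b : R) (rect : rectifiable gamma a b).

Let ab : a <= b. Proof. by case: rect. Qed.

Lemma length_fin t t' : a <= t -> t <= t' -> t' <= b ->
  curve_length gamma t t' = (arclen gamma t t')%:E.
Proof.
move=> at_ tt' t'b; rewrite /arclen fineK// ge0_fin_numE ?curve_length_ge0//.
case: rect => _ _; apply: le_lt_trans.
rewrite (curve_lengthD gamma at_ (le_trans tt' t'b)).
rewrite (curve_lengthD gamma tt' t'b) addeCA leeDl//.
by rewrite adde_ge0// curve_length_ge0.
Qed.

Lemma arclenD t t' t'' : a <= t -> t <= t' -> t' <= t'' -> t'' <= b ->
  arclen gamma t t'' = arclen gamma t t' + arclen gamma t' t''.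
Proof.
move=> h1 h2 h3 h4; apply: EFin_inj; rewrite EFinD -!length_fin//.
- exact: curve_lengthD.
- exact: le_trans h1 _.
- exact: le_trans h4.
- exact: le_trans h3.
Qed.

Lemma arclen_ge0 t t' : t <= t' -> 0 <= arclen gamma t t'.
Proof. by move=> tt'; apply: fine_ge0; exact: curve_length_ge0. Qed.

Lemma mdist_le_arclen t t' : a <= t -> t <= t' -> t' <= b ->
  mdist (gamma t) (gamma t') <= arclen gamma t t'.
Proof.
by move=> h1 h2 h3; rewrite -lee_fin -length_fin// mdist_le_length.
Qed.

Lemma arclen_le t t' : a <= t -> t <= t' -> t' <= b ->
  arclen gamma a t <= arclen gamma a t'.
Proof.
by move=> h1 h2 h3; rewrite (@arclenD a t t')// lerDl arclen_ge0.
Qed.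

Lemma arclen_mdist t t' : a <= t <= b -> a <= t' <= b ->
  mdist (gamma t) (gamma t') <= `|arclen gamma a t - arclen gamma a t'|.
Proof.
wlog tt' : t t' / t <= t'.
  move=> W H H'; have /orP[tt'|tt'] := le_total t t'; first exact: W.
  by rewrite metric_sym distrC W.
move=> /andP[h1 h2] /andP[h3 h4].
rewrite (@arclenD a t t')// opprD addrA subrr add0r normrN ger0_norm ?arclen_ge0//.
exact: mdist_le_arclen.
Qed.

Lemma curve_cvg t e : a <= t <= b -> 0 < e -> exists2 d, 0 < d &
  forall t', a <= t' <= b -> `|t - t'| < d -> mdist (gamma t) (gamma t') < e.
Proof.
move=> tab e0; case: rect => _ cont _.
have tin : `[a, b]%classic t by rewrite /= in_itv.
move/subspace_continuousP : cont => /(_ t tin) /(_ _ (nbhsx_ballx _ _ e0)).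
move=> -[d /= d0 Hd]; exists d => // t' t'ab tt'.
by have := Hd t' tt'; rewrite /= in_itv /= => /(_ t'ab); rewrite ballEmdist.
Qed.

(** The length function has no jumps.  A nearly optimal partition stays nearly
    optimal when a point close to an end of the interval is added to it; the new
    end step is short because the curve is continuous, so what the length of the
    curve gains near that end is small as well. *)
Lemma arclen_left t e : a < t <= b -> 0 < e ->
  exists2 t', a <= t' < t & arclen gamma t' t < e.
Proof.
move=> /andP[at_ tb] e0.
have at' := ltW at_; have e20 : 0 < e / 2 by lra.
have Lt : curve_length gamma a t = (arclen gamma a t)%:E by exact: length_fin.
have : ((arclen gamma a t - e / 2)%:E < curve_length gamma a t)%E.
  by rewrite Lt lte_fin; lra.
rewrite {1}curve_lengthE => /ereal_sup_gt [_ [s ps <-]]; rewrite lte_fin => hs.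
have [t1 /andP[at1 t1t] H1] := polylen_left gamma at_ ps.
have [d d0 Hd] : exists2 d, 0 < d & forall t', a <= t' <= b ->
    `|t - t'| < d -> mdist (gamma t) (gamma t') < e / 2.
  by apply: curve_cvg; rewrite ?at' ?tb.
pose t' := Num.max t1 (t - d / 2).
have tt' : t' < t by rewrite /t' gt_max t1t/=; lra.
have t1t' : t1 <= t' by rewrite /t' le_max lexx.
have at1' : a <= t' := le_trans at1 t1t'.
exists t'; first by rewrite at1'.
have t'b : t' <= b by rewrite (le_trans (ltW tt')).
have := H1 t'; rewrite t1t' tt' => /(_ isT).
rewrite (@length_fin a t')// -EFinD lee_fin.
have : mdist (gamma t) (gamma t') < e / 2.
  apply: Hd; first by rewrite at1'.
  rewrite ger0_norm; last by rewrite subr_ge0 ltW.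
  have : t - d / 2 <= t' by rewrite /t' le_max lexx orbT.
  by lra.
rewrite metric_sym => h1 h2.
have h3 := arclenD (lexx a) at1' (ltW tt') tb.
by lra.
Qed.

Lemma arclen_right t e : a <= t < b -> 0 < e ->
  exists2 t', t < t' <= b & arclen gamma t t' < e.
Proof.
move=> /andP[at_ tb] e0.
have tb' := ltW tb; have e20 : 0 < e / 2 by lra.
have Lt : curve_length gamma t b = (arclen gamma t b)%:E by exact: length_fin.
have : ((arclen gamma t b - e / 2)%:E < curve_length gamma t b)%E.
  by rewrite Lt lte_fin; lra.
rewrite {1}curve_lengthE => /ereal_sup_gt [_ [s ps <-]]; rewrite lte_fin => hs.
have [t1 /andP[tt1 t1b] H1] := polylen_right gamma tb ps.
have [d d0 Hd] : exists2 d, 0 < d & forall t', a <= t' <= b ->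
    `|t - t'| < d -> mdist (gamma t) (gamma t') < e / 2.
  by apply: curve_cvg; rewrite ?at_ ?tb'.
pose t' := Num.min t1 (t + d / 2).
have tt' : t < t' by rewrite /t' lt_min tt1/=; lra.
have t1t' : t' <= t1 by rewrite /t' ge_min lexx.
have t'b : t' <= b := le_trans t1t' t1b.
exists t'; first by rewrite tt'.
have at1' : a <= t' by rewrite (le_trans at_)// ltW.
have := H1 t'; rewrite t1t' tt' => /(_ isT).
rewrite (@length_fin t' b)// -EFinD lee_fin.
have : mdist (gamma t) (gamma t') < e / 2.
  apply: Hd; first by rewrite at1'.
  rewrite ler0_norm; last by rewrite subr_le0 ltW.
  have : t' <= t + d / 2 by rewrite /t' ge_min lexx orbT.
  by lra.
move=> h1 h2.
have h3 := arclenD at_ (ltW tt') t'b (lexx b).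
by lra.
Qed.

(** The supremum of the parameters at which the length is at most [s] has length
    exactly [s], the length function having no jump on either side of it. *)
Lemma arclen_surj (s : R) : 0 <= s <= arclen gamma a b ->
  exists2 t, a <= t <= b & arclen gamma a t = s.
Proof.
move=> /andP[s0 sL].
have arclena : arclen gamma a a = 0 by rewrite /arclen curve_lengthxx.
pose E := [set t | a <= t <= b /\ arclen gamma a t <= s].
have Ea : E a by split; rewrite ?lexx// arclena.
have Eb : ubound E b by move=> t [/andP[]].
have hE : has_sup E by split; [exists a|exists b].
have aE : a <= sup E by exact: (ub_le_sup (proj2 hE) Ea).
have Eleb : sup E <= b by apply: ge_sup => //; exists a.
have tab : a <= sup E <= b by rewrite aE.
exists (sup E) => //; apply/eqP; rewrite eq_le; apply/andP; split.
- have [->|aE'] := eqVneq (sup E) a; first by rewrite arclena.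
  apply/ler_addgt0Pr => e e0.
  have aE2 : a < sup E <= b by rewrite lt_neqAle eq_sym aE' aE.
  have [t' /andP[at' t't] Ht'] := arclen_left aE2 e0.
  have [t1 [/andP[at1 t1b] E1] t't1] : exists2 t1, E t1 & t' < t1.
    by have [t1 ? ?] := sup_gt (proj1 hE) t't; exists t1.
  rewrite (arclenD (lexx a) at' (ltW t't) Eleb) lerD//; last exact: ltW.
  by apply: le_trans E1; apply: arclen_le => //; exact: ltW.
- rewrite leNgt; apply/negP => lts.
  have Eb' : sup E < b.
    rewrite lt_neqAle Eleb andbT; apply/eqP => eb.
    by move: lts; rewrite eb ltNge sL.
  have e0 : 0 < s - arclen gamma a (sup E) by lra.
  have aEb : a <= sup E < b by rewrite aE.
  have [t' /andP[tt' t'b] Ht'] := arclen_right aEb e0.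
  have : E t'.
    split; first by rewrite t'b (le_trans aE)// ltW.
    by rewrite (arclenD (lexx a) aE (ltW tt') t'b); lra.
  by move=> /(ub_le_sup (proj2 hE)); rewrite leNgt tt'.
Qed.

Lemma arclength_paramP (s : R) : 0 <= s <= arclen gamma a b ->
  exists t, [/\ a <= t <= b, arclen gamma a t = s &
    arclength_param gamma a b s = gamma t].
Proof.
move=> sL; have [t0 t0ab t0s] := arclen_surj sL.
rewrite /arclength_param.
set P := [set t | _]; have Pt0 : P t0.
  split=> //; rewrite -t0s length_fin//; by case/andP: t0ab.
have := xgetI a Pt0; set t := xget a P => -[tab ts].
exists t; split => //.
by rewrite /arclen ts.
Qed.

(** Parameters of equal arc length give the same point, so the choice made by
    [xget] is immaterial. *)
Lemma arclength_param_arclen t : a <= t <= b ->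
  arclength_param gamma a b (arclen gamma a t) = gamma t.
Proof.
move=> tab; have /andP[at_ tb] := tab.
have [|t' [t'ab e ->]] := @arclength_paramP (arclen gamma a t).
  by rewrite arclen_ge0//= arclen_le.
apply: mdist_positivity; apply/eqP; rewrite eq_le mdist_ge0 andbT.
by apply: le_trans (arclen_mdist t'ab tab) _; rewrite e subrr normr0.
Qed.

Lemma arclength_param_lip (s s' : R) : 0 <= s <= arclen gamma a b ->
  0 <= s' <= arclen gamma a b ->
  mdist (arclength_param gamma a b s) (arclength_param gamma a b s') <= `|s - s'|.
Proof.
move=> /arclength_paramP[t [tab <- ->]] /arclength_paramP[t' [t'ab <- ->]].
exact: arclen_mdist.
Qed.

End rectifiable.
End curve_length.

(** * Integration along curves *)

Section line_integral.
Context {R : realType}.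

(** Summing the local estimate over [N] subintervals of equal length leaves an
    error of order [1 / N]. *)
Lemma local_to_global (A B : R -> R) (a b C d : R) : a <= b -> 0 <= C -> 0 < d ->
  (forall s s', a <= s -> s <= s' -> s' <= b -> s' - s < d ->
     A s' - A s <= B s' - B s + C * (s' - s) ^+ 2) ->
  A b - A a <= B b - B a.
Proof.
move=> ab C0 d0 H; apply/ler_addgt0Pr => e e0.
pose L := b - a; have L0 : 0 <= L by rewrite subr_ge0.
have [N HN] : exists N : nat, L / d + C * L ^+ 2 / e < N.+1%:R.
  exists (Num.truncn (L / d + C * L ^+ 2 / e)).
  exact: truncnS_gt.
have N0 : 0 < N.+1%:R :> R by rewrite ltr0n.
pose h := L / N.+1%:R; have h0 : 0 <= h by rewrite divr_ge0// ltW.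
have q1 : 0 <= L / d by rewrite divr_ge0// ltW.
have q2 : 0 <= C * L ^+ 2 / e by rewrite divr_ge0 ?mulr_ge0 ?sqr_ge0// ltW.
have hd : h < d.
  by rewrite ltr_pdivrMr// mulrC -ltr_pdivrMr//; lra.
have hb : h * N.+1%:R = b - a by rewrite divfK// gt_eqF.
have step i : (i <= N.+1)%N ->
    A (a + h * i%:R) - A a <= B (a + h * i%:R) - B a + C * i%:R * h ^+ 2.
  elim: i => [|i IH] iN; first by rewrite !mulr0 !mul0r addr0 !subrr addr0.
  have := IH (ltnW iN); have s1 : a <= a + h * i%:R by rewrite lerDl mulr_ge0.
  have e1 : (a + h * i.+1%:R) - (a + h * i%:R) = h by rewrite -natr1; ring.
  have s2 : a + h * i%:R <= a + h * i.+1%:R by rewrite -subr_ge0 e1.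
  have s3 : a + h * i.+1%:R <= b.
    by rewrite -lerBrDl -hb ler_wpM2l// ler_nat.
  have := H _ _ s1 s2 s3; rewrite e1 => /(_ hd).
  by rewrite -(@natr1 R i) [C * (_ + _)]mulrDr mulrDl mulr1; lra.
have e2 : a + (b - a) = b by ring.
have := step N.+1 (leqnn _); rewrite hb e2 => /le_trans; apply.
rewrite lerD2l.
have -> : C * N.+1%:R * h ^+ 2 = C * L ^+ 2 / N.+1%:R.
  by rewrite /h; field; rewrite addrC natr1 gt_eqF.
by rewrite ler_pdivrMr// [e * _]mulrC -ler_pdivrMr//; lra.
Qed.

Let lebesgue := @lebesgue_measure R.

Section primitive.
Context (h : R -> R) (K : R).
Context (h0 : forall s, 0 <= h s) (K0 : 0 <= K).
Context (hlip : forall s s', `|h s - h s'| <= K * `|s - s'|).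

Lemma lip_measurable : measurable_fun setT (EFin \o h).
Proof.
apply/measurable_EFinP; apply: continuous_measurable_fun => x.
have K1 : 0 < K + 1 by rewrite ltr_wpDl.
apply/cvgrPdist_lt => e e0; exists (e / (K + 1)) => /=; first by rewrite divr_gt0.
move=> y /= xy; apply: le_lt_trans (hlip _ _) _.
rewrite ltr_pdivlMr// in xy; have := normr_ge0 (x - y).
by move: `|x - y| xy => z; lra.
Qed.

Let mh D : measurable D -> measurable_fun D (EFin \o h).
Proof. by move=> mD; exact: measurable_funS lip_measurable. Qed.

Lemma integral_bounds s s' : s <= s' ->
  ((h s * (s' - s))%:E <=
     (\int[lebesgue]_(x in `]s, s']) (h x)%:E) + (K * (s' - s) ^+ 2)%:E)%E /\
  (\int[lebesgue]_(x in `]s, s']) (h x)%:E <=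
    ((h s + K * (s' - s)) * (s' - s))%:E)%E.
Proof.
move=> ss'; have d0 : 0 <= s' - s by rewrite subr_ge0.
have ms : measurable `]s, s']%classic by exact: measurable_itv.
have cst k : (\int[lebesgue]_(x in `]s, s']) k%:E = (k * (s' - s))%:E)%E.
  by rewrite integral_cst//= lebesgue_measure_itv/= lte_fin;
    case: ltgtP ss' => // -> _; rewrite mule0 subrr mulr0.
have close x : `]s, s']%classic x -> `|h s - h x| <= K * (s' - s).
  rewrite /= in_itv/= => /andP[sx xs']; apply: le_trans (hlip _ _) _.
  by apply: ler_wpM2l => //; rewrite ltr0_norm ?subr_lt0//; lra.
split.
- rewrite expr2 mulrA -(cst (h s)) -(cst (K * (s' - s))) -ge0_integralD//; last 3 first.
    by move=> x _; rewrite lee_fin.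
    exact: mh.
    by move=> x _; rewrite lee_fin mulr_ge0.
  apply: ge0_le_integral => //.
  + by move=> x _; rewrite lee_fin.
  + by apply: emeasurable_funD; [exact: mh|exact: measurable_cst].
  + move=> x /close; rewrite ler_norml -EFinD lee_fin; lra.
- rewrite -cst; apply: ge0_le_integral => //.
  + by move=> x _; rewrite lee_fin.
  + exact: mh.
  + move=> x /close; rewrite ler_norml lee_fin; lra.
Qed.

Definition primitive s := fine (\int[lebesgue]_(x in `[0%R, s]) (h x)%:E)%E.

Lemma primitiveE s : 0 <= s ->
  (\int[lebesgue]_(x in `[0%R, s]) (h x)%:E)%E = (primitive s)%:E.
Proof.
move=> s0; rewrite /primitive fineK// ge0_fin_numE; last first.
  by apply: integral_ge0 => x _; rewrite lee_fin.
rewrite -integral_itv_obnd_cbnd; last by apply: mh; exact: measurable_itv.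
exact: le_lt_trans (proj2 (integral_bounds s0)) (ltry _).
Qed.

Lemma primitive0 : primitive 0 = 0.
Proof. by rewrite /primitive set_itv1 integral_set1. Qed.

Lemma primitive_bounds s s' : 0 <= s -> s <= s' ->
  h s * (s' - s) <= primitive s' - primitive s + K * (s' - s) ^+ 2 /\
  primitive s' - primitive s <= (h s + K * (s' - s)) * (s' - s).
Proof.
move=> s0 ss'; have s'0 := le_trans s0 ss'.
have E : (primitive s' - primitive s)%:E =
    (\int[lebesgue]_(x in `]s, s']) (h x)%:E)%E.
  rewrite EFinB -(primitiveE s'0).
  have -> : `[0, s']%classic = `[0, s]%classic `|` `]s, s']%classic :> set R.
    by rewrite -itv_bndbnd_setU// bnd_simp.
  rewrite ge0_integral_setU//=.
  - by rewrite primitiveE// addeAC subee// add0e.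
  - by apply: mh; apply: measurableU; exact: measurable_itv.
  - by move=> x _; rewrite lee_fin.
  - apply/disj_setPS => x [/=]; rewrite !in_itv/= => /andP[_ xs] /andP[sx _].
    by move: (lt_le_trans sx xs); rewrite ltxx.
have [] := integral_bounds ss'; rewrite -E -EFinD !lee_fin; split => //.
Qed.
End primitive.
End line_integral.

Section line_integral_bounds.
Context {R : realType} {X : pmetricType R}.

Lemma continuous_borel_measurable (f : R -> X) : continuous f ->
  measurable_fun setT (f : measurableTypeR R -> borel X).
Proof.
move=> cf; apply: (@measurability _ _ (measurableTypeR R) (borel X) setT f open)
  => // _ [U oU <-].
rewrite setTI; apply: open_measurable; exact: open_comp.
Qed.

Section curve.
Context (gamma : R -> X) (a b : R) (rect : rectifiable gamma a b).
Let ab : a <= b. Proof. by case: rect. Qed.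
Let L := arclen gamma a b.
Let L0 : 0 <= L. Proof. exact: arclen_ge0. Qed.
(* Clamping the arc length to [0, L] makes the parametrization 1-Lipschitz on
   the whole line, hence Borel. *)
Let clamp (s : R) := Num.max 0 (Num.min s L).
Let sigma s := arclength_param gamma a b (clamp s).

Let clampP s : 0 <= clamp s <= L.
Proof. by rewrite /clamp le_max lexx/= ge_max L0/= ge_min lexx orbT. Qed.

Let clamp_id s : 0 <= s <= L -> clamp s = s.
Proof. by move=> /andP[s0 sL]; rewrite /clamp min_l// max_r. Qed.

Let clamp_lip s s' : `|clamp s - clamp s'| <= `|s - s'|.
Proof.
wlog ss' : s s' / s <= s'.
  by move=> W; case/orP: (le_total s s') => /W//; rewrite distrC [leRHS]distrC.
rewrite [leRHS]ler0_norm ?subr_le0// ler_norml /clamp; move: L L0 => l l0.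
by case: (leP s l) => ?; case: (leP s' l) => ?; rewrite /Num.max;
  do ?[case: ltP => ?]; apply/andP; split; lra.
Qed.

Let sigma_lip s s' : mdist (sigma s) (sigma s') <= `|s - s'|.
Proof. by apply: le_trans (clamp_lip s s'); apply: arclength_param_lip. Qed.

Let sigma_continuous : continuous sigma.
Proof.
move=> x; apply/metricType_numDomainType.cvgrPdist_lt => e e0.
exists e => //= y xy; exact: le_lt_trans (sigma_lip _ _) xy.
Qed.

Let line_integralE g : line_integral g gamma a b =
  (\int[lebesgue_measure]_(s in `[0%R, L]) g (sigma s))%E.
Proof.
apply: eq_integral => s; rewrite inE /= in_itv/= => sL.
by rewrite /sigma clamp_id.
Qed.

Let measurable_line g : nonneg_borel g ->
  measurable_fun setT (g \o sigma : measurableTypeR R -> \bar R).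
Proof.
move=> [_ mg]; apply: (measurableT_comp mg).
exact: continuous_borel_measurable.
Qed.

(** Monotone convergence along the curve. *)
Lemma line_integral_le_sup (g : X -> \bar R) (G : nat -> X -> R) (M : \bar R) :
  nonneg_borel g -> (forall m, nonneg_borel (EFin \o G m)) ->
  (forall x, {homo G ^~ x : m n / (m <= n)%N >-> m <= n}) ->
  (forall x, g x <= ereal_sup (range (fun m => (G m x)%:E)))%E ->
  (forall m, line_integral (EFin \o G m) gamma a b <= M)%E ->
  (line_integral g gamma a b <= M)%E.
Proof.
move=> bg bG Gnd gG H.
have mI : measurable `[0%R, L]%classic by exact: measurable_itv.
pose f m s := (EFin \o G m) (sigma s).
have f0 m s : (0 <= f m s)%E by case: (bG m) => + _; exact.
have fnd s : {homo f ^~ s : m n / (m <= n)%N >-> (m <= n)%E}.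
  by move=> m n mn; rewrite lee_fin; exact: Gnd.
have mf m : measurable_fun `[0%R, L]%classic (f m).
  apply: measurable_funS (measurable_line (bG m)) => //.
have mono := monotone_convergence (@lebesgue_measure R) mI mf
   (fun m s _ => f0 m s) (fun s _ => fnd s).
have limE s : limn (f ^~ s) = ereal_sup (range (f ^~ s)).
  by apply/cvg_lim => //; apply: ereal_nondecreasing_cvgn; exact: fnd.
rewrite line_integralE; apply: (@le_trans _ _
  (\int[lebesgue_measure]_(s in `[0%R, L]) (limn (f ^~ s)))%E).
  apply: ge0_le_integral => //.
  - by move=> s _; case: bg => + _; exact.
  - by apply: measurable_funS (measurable_line bg).
  - apply: (emeasurable_fun_cvg _ _ mf) => s _.
    by apply: ereal_nondecreasing_is_cvgn; exact: fnd.
  - by move=> s _; rewrite limE; exact: gG.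
rewrite mono; apply: lime_le; first apply: ereal_nondecreasing_is_cvgn.
  move=> m n mn; apply: ge0_le_integral.
  - exact: mI.
  - by move=> s _; exact: f0.
  - exact: mf.
  - exact: mf.
  - by move=> s _; exact: fnd.
apply: nearW => m; have := H m; by rewrite line_integralE.
Qed.

Section lipschitz.
Context (g : X -> R) (K : R) (g0 : forall x, 0 <= g x) (K0 : 0 <= K).
Context (glip : forall x y, `|g x - g y| <= K * mdist x y).
Let h := g \o sigma.

Let h0 s : 0 <= h s. Proof. exact: g0. Qed.

Let hlip s s' : `|h s - h s'| <= K * `|s - s'|.
Proof. by apply: le_trans (glip _ _) _; rewrite ler_wpM2l. Qed.

Let line_primitive : line_integral (EFin \o g) gamma a b = (primitive h L)%:E.
Proof. by rewrite line_integralE -(primitiveE h0 K0 hlip). Qed.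

(** In arc length, over a short step, [u] changes by at most [g] times the step
    and the primitive of [g] by exactly that much, up to quadratic errors. *)
Lemma local_upper_gradient (u : X -> R) (d : R) : 0 < d ->
  (forall x y, mdist x y < d ->
     `|u x - u y| <= (g x + K * mdist x y) * mdist x y) ->
  (`|u (gamma a) - u (gamma b)|%:E <= line_integral (EFin \o g) gamma a b)%E.
Proof.
move=> d0 Hu; rewrite line_primitive lee_fin.
have sL : sigma L = gamma b.
  by rewrite /sigma clamp_id ?L0 ?lexx// arclength_param_arclen// ab lexx.
have s0 : sigma 0 = gamma a.
  rewrite /sigma clamp_id ?L0 ?lexx//.
  have -> : 0 = arclen gamma a a by rewrite /arclen curve_lengthxx.
  by rewrite arclength_param_arclen// ab lexx.
have loc s s' : 0 <= s -> s <= s' -> s' <= L -> s' - s < d ->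
    `|u (sigma s) - u (sigma s')| <=
    primitive h s' - primitive h s + (2 * K) * (s' - s) ^+ 2.
  move=> s0' ss' s'L ss'd.
  have D : mdist (sigma s) (sigma s') <= s' - s.
    by rewrite (le_trans (sigma_lip _ _))// ler0_norm ?subr_le0// opprB.
  apply: le_trans (Hu _ _ (le_lt_trans D ss'd)) _.
  have [P1 _] := primitive_bounds h0 K0 hlip s0' ss'.
  apply: (@le_trans _ _ ((h s + K * (s' - s)) * (s' - s))).
    apply: ler_pM => //; rewrite ?mdist_ge0//.
      by rewrite addr_ge0// mulr_ge0// mdist_ge0.
    by rewrite lerD2l ler_wpM2l.
  by lra.
have KK : 0 <= 2 * K by rewrite mulr_ge0.
rewrite -sL -s0 ler_norml; apply/andP; split.
- have := @local_to_global R (u \o sigma) (primitive h) 0 L _ d L0 KK d0.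
  rewrite primitive0 subr0 /= => /(_ _) W.
  rewrite lerNl opprB; apply: W.
  move=> s s' h1 h2 h3 h4; have := loc s s' h1 h2 h3 h4.
  by rewrite ler_norml; lra.
- have := @local_to_global R (\- (u \o sigma)) (primitive h) 0 L _ d L0 KK d0.
  rewrite primitive0 subr0 /= opprK addrC => /(_ _) W.
  apply: W.
  move=> s s' h1 h2 h3 h4; have := loc s s' h1 h2 h3 h4.
  by rewrite ler_norml; lra.
Qed.

(** The curve has speed at most one, so it sweeps over a short time an arc length
    of at most that time: integrating [g] in arc length costs no more than
    integrating it in time, which [c] dominates. *)
Lemma line_integral_le_lipschitz_curve (c : R -> R) :
  (forall t t', t <= t' -> mdist (gamma t) (gamma t') <= t' - t) ->
  (forall t t', a <= t -> t <= t' -> t' <= b ->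
     (g (gamma t) - K * (t' - t)) * (t' - t) <= c t' - c t) ->
  (line_integral (EFin \o g) gamma a b <= (c b - c a)%:E)%E.
Proof.
move=> gl Hc; rewrite line_primitive lee_fin.
have KK : 0 <= 2 * K by rewrite mulr_ge0.
have := @local_to_global R (primitive h \o arclen gamma a) c a b _ 1 ab KK ltr01.
have -> : (primitive h \o arclen gamma a) b - (primitive h \o arclen gamma a) a
    = primitive h L.
  have c0 : arclen gamma a a = 0 by rewrite /arclen curve_lengthxx.
  by rewrite /= c0 primitive0 subr0.
apply => t t' at_ tt' t'b _.
have tab : a <= t <= b by rewrite at_ (le_trans tt').
have := arclenD rect (lexx a) at_ tt' t'b; rewrite /= => E.
have Ltt : arclen gamma t t' <= t' - t.
  rewrite -lee_fin -(length_fin rect)//; exact: lipschitz_length.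
have Ltt0 := @arclen_ge0 _ _ gamma _ _ tt'.
have s0 : 0 <= arclen gamma a t by exact: arclen_ge0.
have ss' : arclen gamma a t <= arclen gamma a t' by rewrite E lerDl.
have [_] := primitive_bounds h0 K0 hlip s0 ss'.
have -> : h (arclen gamma a t) = g (gamma t).
  rewrite /h /= /sigma clamp_id ?arclength_param_arclen// s0/=.
  by apply: (arclen_le rect) => //; exact: le_trans t'b.
rewrite [X in X - arclen _ _ _]E addrAC subrr add0r => /le_trans; apply.
have := Hc _ _ at_ tt' t'b.
have : (g (gamma t) + K * arclen gamma t t') * arclen gamma t t' <=
       (g (gamma t) + K * (t' - t)) * (t' - t).
  apply: ler_pM => //; first by rewrite addr_ge0// mulr_ge0.
  by rewrite lerD2l ler_wpM2l.
lra.
Qed.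
End lipschitz.
End curve.
End line_integral_bounds.

(** * Borel functions on a metric space *)

Section borel.
Context {R : realType} {X : pmetricType R}.

Lemma lower_semicontinuous_borel (G : X -> \bar R) : lower_semicontinuous G ->
  measurable_fun setT (G : borel X -> \bar R).
Proof.
move=> scG; apply: (@measurability _ _ (borel X) _ setT G _
  (ErealGenOInfty.measurableE R)).
move=> /= _ [_ [a ->]] <-; apply: measurableI => //; apply: sub_sigma_algebra.
by rewrite preimage_itvoy; move/lower_semicontinuousP : scG; exact.
Qed.

Lemma continuous_lsc (g : X -> R) :
  (forall x e, 0 < e ->
    exists2 d, 0 < d & forall y, mdist x y < d -> `|g x - g y| < e) ->
  lower_semicontinuous (EFin \o g).
Proof.
move=> cg x a; rewrite /= lte_fin => ax.
have [|d d0 Hd] := cg x (g x - a); first by rewrite subr_gt0.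
exists (ball x d); first exact: nbhsx_ballx.
by move=> y; rewrite ballEmdist/= => /Hd; rewrite lte_fin ltr_norml; lra.
Qed.

Lemma lipschitz_lsc (g : X -> R) (K : R) : 0 <= K ->
  (forall x y, `|g x - g y| <= K * mdist x y) ->
  lower_semicontinuous (EFin \o g).
Proof.
move=> K0 glip; have K1 : 0 < K + 1 by rewrite ltr_wpDl.
apply: continuous_lsc => x e e0; exists (e / (K + 1)); first by rewrite divr_gt0.
move=> y; rewrite ltr_pdivlMr// => h; apply: le_lt_trans (glip x y) _.
by have := mdist_ge0 x y; lra.
Qed.

Lemma lipschitz_nonneg_borel (g : X -> R) (K : R) : 0 <= K ->
  (forall x y, `|g x - g y| <= K * mdist x y) -> (forall x, 0 <= g x) ->
  nonneg_borel (EFin \o g).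
Proof.
move=> K0 glip g0; split; first by move=> x; rewrite lee_fin.
by apply: lower_semicontinuous_borel; exact: lipschitz_lsc K0 glip.
Qed.

Lemma open_borel (U : set X) : open U -> measurable (U : set (borel X)).
Proof. by move=> oU; apply: sub_sigma_algebra. Qed.

Lemma ball_open (x : X) (r : R) : open (ball x r).
Proof.
rewrite openE /= => y; rewrite {1}ballEmdist/= => xy.
rewrite /interior/= -filter_from_ballE; exists (r - mdist x y) => /=.
  by rewrite subr_gt0.
move=> z; rewrite !ballEmdist/= => yz.
by apply: le_lt_trans (metric_triangle _ y _) _; lra.
Qed.

Lemma ball_borel (x : X) (r : R) : measurable (ball x r : set (borel X)).
Proof. by apply: open_borel; exact: ball_open. Qed.

Lemma mdist_lip (b x y : X) : `|mdist b x - mdist b y| <= mdist x y.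
Proof.
have := metric_triangle b x y; have := metric_triangle b y x.
by rewrite (metric_sym y x) ler_norml; lra.
Qed.
End borel.

(** * Parabolicity from slow volume growth *)

Section radial.
Context {R : realType}.

(** [ramp r] climbs from 0 to 1 between the distances [r / 4] and [r / 2];
    [bump r] is its slope, extended to a Lipschitz function that is supported
    between the distances [r / 8] and [r]. *)
Definition ramp (r t : R) : R := Num.max 0 (Num.min 1 (4 / r * (t - r / 4))).
Definition bump (r t : R) : R :=
  4 / r * Num.max 0 (Num.min 1 (Num.min (t - r / 8) (r - t))).

Lemma ramp_low r t : 0 < r -> t <= r / 4 -> ramp r t = 0.
Proof.
move=> r0 tr; rewrite /ramp max_l// ge_min; apply/orP; right.
by rewrite pmulr_rle0 ?divr_gt0// subr_le0.
Qed.

Lemma ramp_high r t : 0 < r -> r / 2 <= t -> ramp r t = 1.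
Proof.
move=> r0 tr; rewrite /ramp min_l ?max_r//.
rewrite -[leLHS](@mulVf _ (r / 4)) ?gt_eqF ?divr_gt0// invf_div ler_wpM2l//.
  by rewrite divr_ge0// ltW.
lra.
Qed.

Lemma bump_ge0 r t : 0 < r -> 0 <= bump r t.
Proof. by move=> r0; rewrite mulr_ge0 ?divr_ge0// ?(ltW r0)// le_max lexx. Qed.

Lemma bump_le r t : 0 < r -> bump r t <= 4 / r.
Proof.
move=> r0; rewrite ler_piMr ?divr_ge0 ?(ltW r0)//.
by rewrite ge_max ler01 ge_min lexx.
Qed.

Lemma bump_out r t : (t <= r / 8) || (r <= t) -> bump r t = 0.
Proof.
move=> tr; rewrite /bump max_l ?mulr0// !ge_min; case/orP: tr => tr.
  by rewrite [t - _ <= 0]subr_le0 tr orbT.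
by rewrite [r - _ <= 0]subr_le0 tr !orbT.
Qed.

Lemma max_lip (x y x' y' e : R) : `|x - x'| <= e -> `|y - y'| <= e ->
  `|Num.max x y - Num.max x' y'| <= e.
Proof.
rewrite !ler_norml => /andP[h1 h2] /andP[h3 h4].
by case: (leP x y) => ?; case: (leP x' y') => ?; apply/andP; split; lra.
Qed.

Lemma min_lip (x y x' y' e : R) : `|x - x'| <= e -> `|y - y'| <= e ->
  `|Num.min x y - Num.min x' y'| <= e.
Proof.
rewrite !ler_norml => /andP[h1 h2] /andP[h3 h4].
by case: (leP x y) => ?; case: (leP x' y') => ?; apply/andP; split; lra.
Qed.

Lemma ramp_lip r t t' : 0 < r -> `|ramp r t - ramp r t'| <= 4 / r * `|t - t'|.
Proof.
move=> r0; have c0 : 0 <= 4 / r by rewrite divr_ge0// ltW.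
have z : 0 <= 4 / r * `|t - t'| by rewrite mulr_ge0.
apply: max_lip; first by rewrite subrr normr0.
apply: min_lip; first by rewrite subrr normr0.
by rewrite -mulrBr normrM ger0_norm// opprB addrA subrK.
Qed.

Lemma bump_lip r t t' : 0 < r -> `|bump r t - bump r t'| <= 4 / r * `|t - t'|.
Proof.
move=> r0; have c0 : 0 <= 4 / r by rewrite divr_ge0// ltW.
rewrite -mulrBr normrM ger0_norm// ler_wpM2l//.
apply: max_lip; first by rewrite subrr normr0.
apply: min_lip; first by rewrite subrr normr0.
apply: min_lip; first by rewrite opprB addrA subrK.
by rewrite opprB addrCA addrAC subrr add0r distrC addrC.
Qed.

(** [bump r] dominates the slope of [ramp r] on a unit neighborhood of the
    interval where [ramp r] is not constant. *)
Lemma ramp_bump r t t' : 16 <= r -> `|t - t'| < 1 ->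
  `|ramp r t - ramp r t'| <= bump r t * `|t - t'|.
Proof.
move=> r16 tt'; have r0 : 0 < r by lra.
have [h1|h1] := ltP t (r / 4 - 1).
  move: tt'; rewrite ltr_norml => /andP[h2 h3].
  by rewrite !ramp_low//; [rewrite subrr normr0 mulr_ge0 ?bump_ge0|lra|lra].
have [h2|h2] := ltP (r / 2 + 1) t.
  move: tt'; rewrite ltr_norml => /andP[h3 h4].
  by rewrite !ramp_high//; [rewrite subrr normr0 mulr_ge0 ?bump_ge0|lra|lra].
have -> : bump r t = 4 / r.
  rewrite /bump min_l ?max_r ?mulr1// le_min; apply/andP; split; lra.
exact: ramp_lip.
Qed.
End radial.

Section slow_growth.
Context {R : realType} {X : pmetricType R}.
Context (mu : {measure set (borel X) -> \bar R}) (p : R) (b : X) (M : R).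
Context (p_gt1 : 1 < p).

Let p_gt0 : 0 < p. Proof. exact: lt_trans p_gt1. Qed.

Section annuli.
Context (r : nat -> R) (N : nat).
Context (r16 : forall j, 16 <= r j) (r8 : forall j, 8 * r j <= r j.+1).
Context (rM : forall j, (mu (ball b (r j)) <= (M * r j `^ p)%:E)%E).

Let r_gt0 j : 0 < r j. Proof. by have := r16 j; lra. Qed.
Let r_le1 j : 4 / r j <= 1.
Proof. by rewrite ler_pdivrMr// mul1r; have := r16 j; lra. Qed.

Let r_mono i j : (i < j)%N -> 8 * r i <= r j.
Proof.
elim: j => // j IH; rewrite ltnS leq_eqVlt => /orP[/eqP->//|/IH h].
by have := r8 j; have := r16 j; lra.
Qed.

Let n1 : 0 < N.+1%:R^-1 :> R. Proof. by rewrite invr_gt0 ltr0n. Qed.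

Definition annuli_weight (y : X) : R :=
  N.+1%:R^-1 * \sum_(j < N.+1) bump (r j) (mdist b y).
Definition annuli_potential (y : X) : R :=
  N.+1%:R^-1 * \sum_(j < N.+1) ramp (r j) (mdist b y).

Lemma annuli_weight_ge0 y : 0 <= annuli_weight y.
Proof. by rewrite mulr_ge0 ?(ltW n1)// sumr_ge0// => j _; rewrite bump_ge0. Qed.

Let sum_mean (F : 'I_N.+1 -> R) e : (forall j, `|F j| <= e) ->
  N.+1%:R^-1 * `|\sum_(j < N.+1) F j| <= e.
Proof.
move=> H; rewrite ler_pdivrMl ?ltr0n//; apply: le_trans (ler_norm_sum _ _ _) _.
apply: le_trans (ler_sum _ (fun j _ => H j)) _.
by rewrite sumr_const card_ord mulr_natl.
Qed.

Lemma annuli_weight_lip x y :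
  `|annuli_weight x - annuli_weight y| <= 1 * mdist x y.
Proof.
rewrite -mulrBr normrM gtr0_norm// -sumrB; apply: sum_mean => j.
apply: le_trans (bump_lip _ _ (r_gt0 j)) _.
by apply: ler_pM => //; [rewrite divr_ge0// ltW|exact: mdist_lip].
Qed.

Lemma annuli_potential_grad x y : mdist x y < 1 ->
  `|annuli_potential x - annuli_potential y| <=
     (annuli_weight x + 1 * mdist x y) * mdist x y.
Proof.
move=> xy; rewrite mulrDl; apply: (@le_trans _ _ (annuli_weight x * mdist x y)).
  rewrite -mulrBr normrM gtr0_norm// -mulrA ler_pM2l// -sumrB mulr_suml.
  apply: le_trans (ler_norm_sum _ _ _) _; apply: ler_sum => j _.
  have h := mdist_lip b x y.
  apply: le_trans (ramp_bump (r16 j) (le_lt_trans h xy)) _.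
  by rewrite ler_wpM2l// bump_ge0.
by rewrite lerDl !mulr_ge0// mdist_ge0.
Qed.

Lemma annuli_potential_low y : mdist b y <= r 0%N / 4 -> annuli_potential y = 0.
Proof.
move=> h; rewrite /annuli_potential big1 ?mulr0// => j _; rewrite ramp_low//.
suff : r 0%N <= r j by lra.
by case: (nat_of_ord j) => [|i]//; have := @r_mono 0%N i.+1 isT; have := r16 0%N; lra.
Qed.

Lemma annuli_potential_high y : r N <= mdist b y -> annuli_potential y = 1.
Proof.
move=> h; rewrite /annuli_potential (eq_bigr (fun=> 1)).
  by rewrite sumr_const card_ord mulVf// pnatr_eq0.
move=> j _; rewrite ramp_high//; have := r16 j.
by have := ltn_ord j; rewrite ltnS leq_eqVlt => /orP[/eqP ->|/r_mono]; lra.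
Qed.

(** The annuli are disjoint, so at each point at most one term contributes. *)
Lemma annuli_weight_pow y : annuli_weight y `^ p <=
  \sum_(j < N.+1) (N.+1%:R^-1 * (4 / r j)) `^ p * \1_(ball b (r j)) y.
Proof.
have pos (j : 'I_N.+1) : 0 <= (N.+1%:R^-1 * (4 / r j)) `^ p * \1_(ball b (r j)) y.
  by rewrite mulr_ge0 ?powR_ge0.
have [[j Hj]|H] := pselect (exists j : 'I_N.+1, bump (r j) (mdist b y) != 0);
    last first.
  rewrite /annuli_weight big1 => [|j _].
    by rewrite mulr0 powR0 ?sumr_ge0// gt_eqF.
  by apply/eqP; apply: contra_notT H => H; exists j.
have jin : mdist b y < r j /\ r j / 8 < mdist b y.
  by split; rewrite ltNge; apply: contra_neqN Hj => h; rewrite bump_out// h ?orbT.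
rewrite /annuli_weight (bigD1 j)//= big1 ?addr0; last first.
  move=> i ij; apply: bump_out.
  have [ltij|ltji|eij] := ltngtP i j.
  - by apply/orP; right; have := r_mono ltij; lra.
  - by apply/orP; left; have := r_mono ltji; lra.
  - by move: ij; rewrite (_ : i = j) ?eqxx//; exact: val_inj.
rewrite (bigD1 j)//=; apply: ler_wpDr; first exact: sumr_ge0.
rewrite indicE mem_set ?mulr1; last by rewrite ballEmdist/=; case: jin.
have nn (z : R) : 0 <= z -> N.+1%:R^-1 * z \is Num.nneg.
  by move=> z0; rewrite nnegrE mulr_ge0// ltW.
apply: ge0_ler_powR; rewrite ?nn ?bump_ge0 ?divr_ge0 ?(ltW (r_gt0 j)) ?(ltW p_gt0)//.
by rewrite ler_pM2l// bump_le.
Qed.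

(** Each annulus contributes at most [4 `^ p * M * N.+1%:R `^ (- p)], whatever its
    radius. *)
Lemma annuli_weight_integral :
  (\int[mu]_x ((EFin \o annuli_weight) x `^ p) <=
    (4 `^ p * M * N.+1%:R `^ (1 - p))%:E)%E.
Proof.
have mw : measurable_fun setT (EFin \o annuli_weight : borel X -> \bar R).
  by case: (lipschitz_nonneg_borel ler01 annuli_weight_lip annuli_weight_ge0).
pose c j := (N.+1%:R^-1 * (4 / r j)) `^ p.
apply: (@le_trans _ _ (\int[mu]_x
    (\sum_(j < N.+1) (c j)%:E * (\1_(ball b (r j)) x)%:E))%E).
  apply: ge0_le_integral => //.
  - by move=> x _; exact: poweR_ge0.
  - apply: (measurableT_comp (measurable_poweR _)) => //.
  - apply: emeasurable_sum => j; apply: measurable_funeM.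
    by apply/measurable_EFinP; apply: measurable_indic; exact: ball_borel.
  - move=> x _; rewrite /comp poweR_EFin.
    under eq_bigr do rewrite -EFinM.
    by rewrite sumEFin lee_fin annuli_weight_pow.
have mi j : measurable_fun setT (fun x : borel X => (\1_(ball b (r j)) x)%:E : \bar R).
  by apply/measurable_EFinP; apply: measurable_indic; exact: ball_borel.
rewrite ge0_integral_sum//; last 2 first.
  by move=> j; apply: measurable_funeM.
  by move=> j x _; rewrite -EFinM lee_fin mulr_ge0 ?powR_ge0.
apply: (@le_trans _ _ (\sum_(j < N.+1) (N.+1%:R^-1 `^ p * (4 `^ p * M))%:E)%E).
  apply: lee_sum => j _; rewrite ge0_integralZl//; last by rewrite lee_fin powR_ge0.
  rewrite integral_indic ?setIT//; last exact: ball_borel.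
  apply: (@le_trans _ _ ((c j)%:E * (M * r j `^ p)%:E)%E).
    by apply: lee_wpmul2l => //; rewrite lee_fin powR_ge0.
  rewrite -EFinM lee_fin /c powRM ?(ltW n1) ?divr_ge0 ?(ltW (r_gt0 j))//.
  rewrite powRM ?invr_ge0 ?(ltW (r_gt0 j))// -!mulrA ler_wpM2l ?powR_ge0//.
  rewrite ler_wpM2l ?powR_ge0// mulrCA -powRM ?invr_ge0 ?(ltW (r_gt0 j))//.
  by rewrite mulVf ?gt_eqF// powR1 mulr1.
rewrite sumEFin lee_fin sumr_const card_ord -[leLHS]mulr_natl.
suff -> : N.+1%:R `^ (1 - p) = N.+1%:R * N.+1%:R^-1 `^ p :> R by lra.
rewrite powRB; last by rewrite pnatr_eq0/= implybT.
by rewrite powRr1// -powRN -(powR_inv1 (ler0n _ _)) -powRrM mulN1r.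
Qed.

End annuli.

(** The first radius is so large that the potential vanishes on the given ball,
    while it equals 1 wherever a curve that goes to infinity ends up; the energy
    tends to zero with the number of annuli because [1 < p]. *)
Lemma parabolic_of_slow_growth : 0 <= M ->
  (forall rho, exists r, rho <= r /\ (mu (ball b r) <= (M * r `^ p)%:E)%E) ->
  parabolic mu p.
Proof.
move=> M0 /choice[f Hf] [x0 [r0 [r0_gt0 mod_gt0]]].
have frho rho : rho <= f rho by case: (Hf rho).
have fM rho : (mu (ball b (f rho)) <= (M * f rho `^ p)%:E)%E by case: (Hf rho).
pose s := Num.max 16 (4 * (mdist b x0 + r0 + 1)).
pose r j := f (iter j (fun t => Num.max 16 (8 * f t)) s).
have r16 j : 16 <= r j.
  by apply: le_trans (frho _); case: j => [|j] /=; rewrite le_max lexx.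
have r8 j : 8 * r j <= r j.+1.
  by apply: le_trans (frho _) => /=; rewrite le_max lexx orbT.
have rM j : (mu (ball b (r j)) <= (M * r j `^ p)%:E)%E by exact: fM.
have adm N : admissible (curves_to_infinity x0 r0) (EFin \o annuli_weight r N).
  split; first exact: lipschitz_nonneg_borel ler01
    (annuli_weight_lip N r16) (annuli_weight_ge0 N r16).
  move=> I gamma [/= -> _ cl0 far] [_ rec].
  have [n Hn] : exists n : nat, mdist b x0 + r N < n%:R * r0.
    exists (Num.truncn ((mdist b x0 + r N) / r0)).+1.
    by rewrite -ltr_pdivrMr//; exact: truncnS_gt.
  have [t t0 /(_ t (lexx t)) Ht] := far n.
  apply: (@le_trans _ _ (line_integral (EFin \o annuli_weight r N) gamma 0 t));
    last first.
    apply: ereal_sup_ubound; exists (0, t) => //=.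
    by rewrite !in_itv/= lexx (ltW t0).
  have rect : rectifiable gamma 0 t.
    by apply: rec; rewrite ?in_itv/= ?lexx ?(ltW t0).
  have ug := @annuli_potential_grad r N r16.
  apply: le_trans (local_upper_gradient rect (annuli_weight_ge0 N r16) ler01
     (annuli_weight_lip N r16) ltr01 ug).
  rewrite (@annuli_potential_low _ N) => //; last first.
    have [y [] ] := cl0 _ (nbhsx_ballx (gamma 0) 1 ltr01).
    rewrite !ballEmdist/= => h1 h2.
    have h3 := metric_triangle b x0 (gamma 0).
    have h4 := metric_triangle x0 y (gamma 0).
    rewrite (metric_sym y) in h4.
    have : s <= r 0%N by exact: frho.
    by rewrite /s ge_max => /andP[_]; lra.
  rewrite annuli_potential_high//; last first.
    move: Ht; rewrite ballEmdist/= => /negP; rewrite -leNgt => Ht.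
    have := metric_triangle x0 b (gamma t); rewrite (metric_sym x0 b); lra.
  by rewrite sub0r normrN normr1.
have small N : (modulus mu p (curves_to_infinity x0 r0) <=
    (4 `^ p * M * N.+1%:R `^ (1 - p))%:E)%E.
  apply: le_trans (annuli_weight_integral N r16 r8 rM).
  by apply: ereal_inf_lbound; exists (EFin \o annuli_weight r N).
suff : (modulus mu p (curves_to_infinity x0 r0) <= 0)%E by rewrite leNgt mod_gt0.
apply/lee_addgt0Pr => e e0; rewrite add0e.
pose C := 4 `^ p * M / e.
have C0 : 0 <= C by rewrite divr_ge0 ?(ltW e0)// mulr_ge0// powR_ge0.
have q0 : 0 < p - 1 by rewrite subr_gt0.
pose N := Num.truncn (C `^ (p - 1)^-1).
apply: le_trans (small N) _; rewrite lee_fin.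
have NC : C <= N.+1%:R `^ (p - 1).
  rewrite [leLHS](_ : C = (C `^ (p - 1)^-1) `^ (p - 1)); last first.
    by rewrite -powRrM mulVf ?powRr1// gt_eqF.
  apply: ge0_ler_powR; rewrite ?nnegrE ?powR_ge0 ?ler0n ?(ltW q0)//.
  exact/ltW/truncnS_gt.
have N1 : 0 < N.+1%:R `^ (p - 1) :> R by rewrite powR_gt0// ltr0n.
by rewrite -opprB powRN ler_pdivrMr// [e * _]mulrC -ler_pdivrMr.
Qed.
End slow_growth.

(** * Lower semicontinuous majorants *)

Section outer_regularity.
Context {R : realType} {X : pmetricType R}.
Implicit Types (A U V : set X).

Lemma small_of_decreasing (m : {measure set (borel X) -> \bar R})
    (D : nat -> set X) (e e' : R) :
  (m setT < +oo)%E -> (forall n, open (D n)) -> nonincreasing_seq D ->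
  (m (\bigcap_n D n) <= e%:E)%E -> e < e' -> exists n, (m (D n) <= e'%:E)%E.
Proof.
move=> mT oD nD mD ee'.
have bD n : measurable (D n : set (borel X)) by exact: open_borel.
have cv : m \o D @ \oo --> m (\bigcap_n D n).
  apply: nonincreasing_cvg_mu => //; last exact: bigcapT_measurable.
  by apply: le_lt_trans mT; apply: le_measure; rewrite ?inE//; exact: measurableT.
have lt : (m (\bigcap_n D n) < e'%:E)%E by apply: le_lt_trans mD _; rewrite lte_fin.
have [//|H] := pselect (exists n, (m (D n) <= e'%:E)%E); exfalso.
move: lt; apply/negP; rewrite -leNgt -(cvg_lim _ cv)//; apply: lime_ge.
  by apply/cvg_ex; exists (m (\bigcap_n D n)).
apply: nearW => n /=; rewrite leNgt; apply/negP => h; apply: H.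
by exists n; exact: ltW.
Qed.

(** The pairs of open sets treat a set and its complement alike, which makes
    the class of sets with this property obviously stable under complement. *)
Definition regular_set (m : {measure set (borel X) -> \bar R}) A :=
  forall e : R, 0 < e -> exists U V, [/\ open U, open V, A `<=` U, ~` A `<=` V &
    (m (U `&` V) <= e%:E)%E].

(** Sets with this property form a sigma-algebra.  An open set belongs to it
    since it meets the neighborhoods of its complement in sets that decrease to
    the empty set.  For a countable union, finitely many of the sets [V] suffice
    up to a small error, again by continuity of the measure from above. *)
Lemma finite_measure_regular (m : {measure set (borel X) -> \bar R}) A :
  (m setT < +oo)%E -> measurable (A : set (borel X)) -> regular_set m A.
Proof.
move=> mT; suff : <<s open >> `<=` regular_set m by exact.
apply: smallest_sub; last first.
  move=> U oU e e0.
  pose V n := \bigcup_(y in ~` U) ball y (n.+1%:R^-1).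
  have oV n : open (V n) by apply: bigcup_open => y _; exact: ball_open.
  have Vc n : ~` U `<=` V n.
    by move=> y Uy; exists y => //; apply: ballxx; rewrite invr_gt0 ltr0n.
  have [||||n Hn] := @small_of_decreasing m (fun n => U `&` V n) 0 e mT.
  - by move=> n; exact: openI.
  - move=> i j ij; apply/subsetPset; apply: setIS => x [y Uy yx]; exists y => //.
    by apply: le_ball yx; rewrite lef_pV2 ?posrE ?ltr0n// ler_nat.
  - suff -> : \bigcap_n (U `&` V n) = set0 by rewrite measure0.
    rewrite -subset0 => x Hx.
    have [Ux _] := Hx 0%N Logic.I.
    move: oU; rewrite openE => /(_ x Ux); rewrite /interior/= -filter_from_ballE.
    move=> [d /= d0 dU].
    have [n Hn] : exists n : nat, d^-1 < n.+1%:R.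
      by exists (Num.truncn d^-1); exact: truncnS_gt.
    have [_ [y Uy yx]] := Hx n Logic.I; apply: Uy; apply: dU.
    apply: ball_sym; apply: le_ball yx.
    by rewrite invf_ple ?posrE ?ltr0n//; exact: ltW.
  - exact: e0.
  by exists U, (V n); split.
split.
- move=> e e0; exists set0, setT; split => //; [exact: open0|exact: openT|].
  by rewrite set0I measure0 lee_fin ltW.
- move=> B HB e /HB[U [V [oU oV BU BV h]]]; exists V, U; split => //.
  + by rewrite setTD.
  + by rewrite setTD setCK.
  + by rewrite setIC.
move=> F HF e e0.
have e20 k : 0 < e / 2 / (2 ^ k.+1)%:R.
  by rewrite !divr_gt0 ?ltr0n ?expn_gt0.
have /choice[UV HUV] : forall k, exists UV : set X * set X,
    [/\ open UV.1, open UV.2, F k `<=` UV.1, ~` F k `<=` UV.2 &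
    (m (UV.1 `&` UV.2) <= (e / 2 / (2 ^ k.+1)%:R)%:E)%E].
  by move=> k; have [U [V H]] := HF k _ (e20 k); exists (U, V).
pose U := \bigcup_k (UV k).1.
have oU : open U by apply: bigcup_open => k _; case: (HUV k).
pose V n := [set x | forall k, (k < n)%N -> (UV k).2 x].
have oV n : open (V n).
  elim: n => [|n IH]; first by rewrite (_ : V 0 = setT)//; [exact: openT|exact/seteqP].
  suff -> : V n.+1 = V n `&` (UV n).2 by apply: openI => //; case: (HUV n).
  apply/seteqP; split=> x.
    by move=> h; split => [k kn|]; apply: h => //; exact: ltnW.
  by move=> [h1 h2] k; rewrite ltnS leq_eqVlt => /orP[/eqP->|]//; exact: h1.
have [||||n Hn] := @small_of_decreasing m (fun n => U `&` V n) (e / 2) e mT.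
- by move=> n; exact: openI.
- move=> i j ij; apply/subsetPset; apply: setIS => x h k ki; apply: h.
  exact: leq_trans ij.
- apply: (@le_trans _ _ (m (\bigcup_k ((UV k).1 `&` (UV k).2)))).
    apply: le_measure; rewrite ?inE.
    + by apply: bigcapT_measurable => n; apply: open_borel; exact: openI.
    + apply: bigcupT_measurable => n; apply: open_borel.
      by case: (HUV n) => *; exact: openI.
    + move=> x h; have [[k _ kx] _] := h 0%N Logic.I; exists k => //; split => //.
      by have [_ /(_ k)] := h k.+1 Logic.I; exact.
  apply: le_trans (generalized_Boole_inequality _ _ _) _.
  + by move=> k; apply: open_borel; case: (HUV k) => *; exact: openI.
  + apply: bigcupT_measurable => n; apply: open_borel.
    by case: (HUV n) => *; exact: openI.
  apply: le_trans (epsilon_trick0 xpredT _); last by rewrite divr_ge0// ltW.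
  by apply: lee_nneseries => // k _; case: (HUV k).
- by lra.
exists U, (V n); split => //.
- by move=> x [k _ Fx]; exists k => //; case: (HUV k) => _ _ + _ _; exact.
- move=> x nF k _; case: (HUV k) => _ _ _ + _; apply => Fx; apply: nF.
  by exists k.
Qed.

(** The measure is finite on each [ball b n], and the errors allowed on these
    balls are summable. *)
Lemma outer_regular (mu : {measure set (borel X) -> \bar R}) (b : X) A (e : R) :
  (forall n : nat, (mu (ball b n%:R) < +oo)%E) ->
  measurable (A : set (borel X)) -> 0 < e ->
  exists U, [/\ open U, A `<=` U & (mu (U `\` A) <= e%:E)%E].
Proof.
move=> mfin mA e0.
have e20 k : 0 < e / (2 ^ k.+1)%:R by rewrite !divr_gt0 ?ltr0n ?expn_gt0.
have mb n : measurable (ball b n%:R : set (borel X)) by exact: ball_borel.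
have /choice[U HU] : forall n, exists U, [/\ open U, A `<=` U &
    (mu ((U `\` A) `&` ball b n%:R) <= (e / (2 ^ n.+1)%:R)%:E)%E].
  move=> n; pose m := mrestr mu (mb n).
  have mT : (m setT < +oo)%E by rewrite /m /mrestr setTI.
  have [U [V [oU oV AU AV h]]] := @finite_measure_regular m A mT mA _ (e20 n).
  exists U; split => //; apply: le_trans h.
  apply: le_measure; rewrite ?inE.
  + by apply: measurableI => //; apply: measurableD => //; exact: open_borel.
  + by apply: measurableI => //; apply: open_borel; exact: openI.
  + by apply: setSI; apply: setIS.
have mU n : measurable ((U n `\` A) `&` ball b n%:R : set (borel X)).
  apply: measurableI => //; apply: measurableD => //; apply: open_borel.
  by case: (HU n).
exists (\bigcup_n (U n `&` ball b n%:R)); split.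
- by apply: bigcup_open => n _; apply: openI; [case: (HU n)|exact: ball_open].
- move=> x Ax; exists (Num.truncn (mdist b x)).+1 => //; split.
    by case: (HU (Num.truncn (mdist b x)).+1) => _ + _; exact.
  by rewrite ballEmdist /=; exact: truncnS_gt.
- rewrite setD_bigcupl.
  apply: (@le_trans _ _ (mu (\bigcup_n ((U n `\` A) `&` ball b n%:R)))).
    apply: le_measure; rewrite ?inE.
    + apply: bigcupT_measurable => n; apply: measurableD => //.
      apply: measurableI => //; apply: open_borel.
      by case: (HU n).
    + exact: bigcupT_measurable.
    + by apply: subset_bigcup => n _ x [[? ?] ?].
  apply: le_trans (generalized_Boole_inequality _ mU _) _.
    exact: bigcupT_measurable.
  apply: le_trans (epsilon_trick0 xpredT (ltW e0)).
  by apply: lee_nneseries => // k _; case: (HU k).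
Qed.
End outer_regularity.

Section vitali_caratheodory.
Context {R : realType} {X : pmetricType R}.
Context (mu : {measure set (borel X) -> \bar R}) (b : X).
Context (mufin : forall n : nat, (mu (ball b n%:R) < +oo)%E).
Local Open Scope ereal_scope.
Implicit Types f F : X -> \bar R.

Lemma lscD F G : (forall x, 0 <= F x) -> (forall x, 0 <= G x) ->
  lower_semicontinuous F -> lower_semicontinuous G ->
  lower_semicontinuous (F \+ G).
Proof.
move=> F0 G0 scF scG x a aFG.
suff [s [t [sF tG ast]]] : exists s t : R, [/\ s%:E < F x, t%:E < G x & (a <= s + t)%R].
  have [V nV HV] := scF x s sF; have [W nW HW] := scG x t tG.
  exists (V `&` W); first exact: filterI.
  move=> y [/HV h1 /HW h2]; apply: (@le_lt_trans _ _ (s%:E + t%:E)).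
    by rewrite -EFinD lee_fin.
  exact: lteD.
move: (F0 x) (G0 x) aFG => /=; case: (F x) => [f| |]; case: (G x) => [g| |] //= f0 g0.
- rewrite -EFinD lte_fin => h; exists (f - (f + g - a) / 2)%R, (g - (f + g - a) / 2)%R.
  by rewrite !lte_fin; split; lra.
- move=> _; exists (f - 1)%R, (a - f + 1)%R; rewrite lte_fin ltry; split => //; lra.
- move=> _; exists (a - g + 1)%R, (g - 1)%R; rewrite lte_fin ltry; split => //; lra.
- by move=> _; exists a, 0%R; rewrite !ltry; split => //; lra.
Qed.

(** Where the series exceeds [a], a partial sum does, and finite sums of
    nonnegative lower semicontinuous functions are lower semicontinuous. *)
Lemma lsc_series (F : nat -> X -> \bar R) : (forall k x, 0 <= F k x) ->
  (forall k, lower_semicontinuous (F k)) ->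
  lower_semicontinuous (fun x => \sum_(0 <= k <oo) F k x).
Proof.
move=> F0 scF x a ax.
have part n : lower_semicontinuous (fun x => \sum_(0 <= k < n) F k x).
  elim: n => [|n IH].
    move=> y c; rewrite big_nil => c0.
    by exists setT; [exact: filterT|move=> z _; rewrite big_nil].
  have -> : (fun x => \sum_(0 <= k < n.+1) F k x) =
      (fun x => \sum_(0 <= k < n) F k x) \+ F n.
    by apply/funext => y; rewrite big_nat_recr.
  by apply: lscD => // y; exact: sume_ge0.
have [n Hn] : exists n, a%:E < \sum_(0 <= k < n) F k x.
  have [//|H] := pselect (exists n, a%:E < \sum_(0 <= k < n) F k x); exfalso.
  move: ax; apply/negP; rewrite -leNgt; apply: lime_le.
    by apply: is_cvg_nneseries => k _ _; exact: F0.
  by apply: nearW => n; rewrite leNgt; apply/negP => h; apply: H; exists n.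
have [V nV HV] := part n x a Hn; exists V => // y /HV /lt_le_trans; apply.
by apply: nneseries_lim_ge => k _ _; exact: F0.
Qed.

Definition lsc_majorizable f := [/\ (forall x, 0 <= f x),
  measurable_fun setT (f : borel X -> \bar R) &
  forall e : R, (0 < e)%R -> exists F, [/\ lower_semicontinuous F,
    forall x, f x <= F x & \int[mu]_x F x <= \int[mu]_x f x + e%:E]].

Lemma lsc_majorizable_indic (A : set X) (c : R) : (0 <= c)%R ->
  measurable (A : set (borel X)) -> lsc_majorizable (fun x => (c * \1_A x)%:E).
Proof.
move=> c0 mA; have mi (B : set X) : measurable (B : set (borel X)) ->
    measurable_fun setT (fun x : borel X => (\1_B x)%:E : \bar R).
  by move=> mB; apply/measurable_EFinP; exact: measurable_indic.
split.
- by move=> x; rewrite lee_fin mulr_ge0.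
- by under eq_fun do rewrite EFinM; apply: measurable_funeM; exact: mi.
move=> e e0; have ce : (0 < e / (c + 1))%R by rewrite divr_gt0//; lra.
have [U [oU AU HU]] := outer_regular mufin mA ce.
have mU := open_borel oU.
have int B : measurable (B : set (borel X)) ->
    \int[mu]_x (c * \1_B x)%:E = c%:E * mu B.
  move=> mB; under eq_integral do rewrite EFinM.
  rewrite ge0_integralZl//; last by exact: mi.
  by rewrite integral_indic// setIT.
exists (fun x => (c * \1_U x)%:E); split.
- move=> x a; rewrite lte_fin indicE; have [xU|xU] := boolP (x \in U) => h.
    rewrite inE in xU; exists U; first exact: open_nbhs_nbhs.
    by move=> y Uy; rewrite lte_fin indicE mem_set.
  exists setT; first exact: filterT.
  move=> y _; rewrite lte_fin; apply: lt_le_trans h _.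
  by rewrite mulr0 mulr_ge0.
- move=> x; rewrite lee_fin ler_wpM2l// !indicE ler_nat.
  by have [/set_mem/AU/mem_set->|] := boolP (x \in A).
- rewrite !int//.
  have -> : mu U = mu A + mu (U `\` A).
    rewrite -measureU//; last 2 first.
    + exact: measurableD.
    + by rewrite setDE setIC -setIA setICl setI0.
    by rewrite setDUK.
  rewrite ge0_muleDr// leeD2l//.
  apply: le_trans (lee_wpmul2l _ HU) _ => //.
  rewrite -EFinM lee_fin mulrA ler_pdivrMr; last lra.
  by rewrite mulrC ler_pM2l//; lra.
Qed.

Lemma lsc_majorizableD f g : lsc_majorizable f -> lsc_majorizable g ->
  lsc_majorizable (f \+ g).
Proof.
move=> [f0 mf Hf] [g0 mg Hg]; split.
- by move=> x; rewrite adde_ge0.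
- exact: emeasurable_funD.
move=> e e0; have e20 : (0 < e / 2)%R by lra.
have [F [scF fF IF]] := Hf _ e20; have [G [scG gG IG]] := Hg _ e20.
have F0 x : 0 <= F x := le_trans (f0 x) (fF x).
have G0 x : 0 <= G x := le_trans (g0 x) (gG x).
exists (F \+ G); split; first exact: lscD.
  by move=> x; exact: leeD.
rewrite ge0_integralD//; [|exact: lower_semicontinuous_borel..].
rewrite [leRHS](_ : _ = \int[mu]_x f x + (e / 2)%:E + (\int[mu]_x g x + (e / 2)%:E)).
  exact: leeD.
by rewrite addeACA -EFinD -splitr ge0_integralD.
Qed.

Lemma lsc_majorizable_sum (I : Type) (s : seq I) (f : I -> X -> \bar R) :
  (forall i, lsc_majorizable (f i)) ->
  lsc_majorizable (fun x => \sum_(i <- s) f i x).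
Proof.
move=> H; elim: s => [|i s IH].
  have := @lsc_majorizable_indic set0 0 (lexx _) measurable0.
  by congr lsc_majorizable; apply/funext => x; rewrite mul0r big_nil.
by under eq_fun do rewrite big_cons; exact: lsc_majorizableD.
Qed.

Lemma lsc_majorizable_series (f : nat -> X -> \bar R) :
  (forall k, lsc_majorizable (f k)) ->
  lsc_majorizable (fun x => \sum_(0 <= k <oo) f k x).
Proof.
move=> H; have f0 k x : 0 <= f k x by case: (H k).
have mf k : measurable_fun setT (f k : borel X -> \bar R) by case: (H k).
split.
- by move=> x; exact: nneseries_ge0.
- exact: ge0_emeasurable_sum.
move=> e e0.
have e20 k : (0 < e / (2 ^ k.+1)%:R)%R by rewrite !divr_gt0 ?ltr0n ?expn_gt0.
have /choice[F HF] : forall k, exists F, [/\ lower_semicontinuous F,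
    forall x, f k x <= F x &
    \int[mu]_x F x <= \int[mu]_x f k x + (e / (2 ^ k.+1)%:R)%:E].
  by move=> k; case: (H k) => _ _ /(_ _ (e20 k)).
have scF k : lower_semicontinuous (F k) by case: (HF k).
have fF k x : f k x <= F k x by case: (HF k).
have F0 k x : 0 <= F k x := le_trans (f0 k x) (fF k x).
exists (fun x => \sum_(0 <= k <oo) F k x); split.
- exact: lsc_series.
- by move=> x; apply: lee_nneseries => // k _.
- rewrite !integral_nneseries//; last first.
    by move=> k; exact: lower_semicontinuous_borel.
  apply: le_trans (epsilon_trick xpredT _ (ltW e0)); last first.
    by move=> k; exact: integral_ge0.
  apply: lee_nneseries => k _; first by move=> _; exact: integral_ge0.
  by case: (HF k).
Qed.

Import HBNNSimple HBSimple.

Lemma lsc_majorizable_simple (h : {sfun borel X >-> R}) :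
  (forall x, 0 <= h x)%R -> lsc_majorizable (EFin \o h).
Proof.
move=> h0.
have -> : EFin \o h = (fun x => \sum_(y <- finmap.enum_fset (fset_set (range h)))
    (Num.max 0 y * \1_(h @^-1` [set y]) x)%R%:E).
  apply/funext => x; rewrite /= sumEFin; congr EFin.
  rewrite fimfunE fsbig_finite//=; apply: eq_big_seq => y.
  rewrite in_fset_set// => /set_mem[z _ <-].
  by rewrite max_r.
apply: lsc_majorizable_sum => y; apply: lsc_majorizable_indic.
  by rewrite le_max lexx.
exact: measurable_funPTI.
Qed.

(** Writing the simple functions that increase to [f] as partial sums, [f] is a
    series of nonnegative multiples of indicators of Borel sets, each of which
    lies in an open set of barely larger measure. *)
Theorem vitali_caratheodory f : nonneg_borel f -> lsc_majorizable f.
Proof.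
move=> [f0 mf].
pose g := nnsfun_approx measurableT mf.
pose d k : {sfun borel X >-> R} :=
  if k is j.+1 then (g j.+1 \- g j)%R : {sfun borel X >-> R} else g 0%N.
have gnd k x : (g k x <= g k.+1 x)%R.
  by have /lefP := nd_nnsfun_approx measurableT mf (leqnSn k); exact.
have d0 k x : (0 <= d k x)%R by case: k => [|k] //=; rewrite subr_ge0.
have dsum n x : \sum_(0 <= k < n.+1) (d k x)%:E = (g n x)%:E.
  elim: n => [|n IH]; first by rewrite big_nat1.
  by rewrite big_nat_recr//= IH -EFinD addrC subrK.
have -> : f = (fun x => \sum_(0 <= k <oo) (EFin \o d k) x).
  apply/funext => x; apply/esym/cvg_lim => //; rewrite -cvg_shiftS /=.
  under eq_fun do rewrite dsum.
  by apply: cvg_nnsfun_approx => //.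
by apply: lsc_majorizable_series => k; exact: lsc_majorizable_simple.
Qed.
End vitali_caratheodory.

(** * Lipschitz minorants *)

Section lipschitz_regularization.
Context {R : realType} {X : pmetricType R} (G : X -> \bar R).
Context (G0 : forall x, (0 <= G x)%E).

Definition capped (m : nat) y : R := fine (mine (G y) m%:R%:E).
(** The largest [m]-Lipschitz function below [G] cut at [m]. *)
Definition lipreg (m : nat) (x : X) : R :=
  inf [set capped m y + m%:R * mdist x y | y in setT].

Lemma cappedE m y : (capped m y)%:E = mine (G y) m%:R%:E.
Proof.
rewrite /capped fineK// ge0_fin_numE; last by rewrite le_min G0 lee_fin ler0n.
by rewrite gt_min ltry orbT.
Qed.

Lemma capped_ge0 m y : 0 <= capped m y.
Proof. by rewrite -lee_fin cappedE le_min G0 lee_fin ler0n. Qed.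

Lemma capped_le m y : capped m y <= m%:R.
Proof. by rewrite -lee_fin cappedE ge_min lexx orbT. Qed.

Let lbnd m x : lbound [set capped m y + m%:R * mdist x y | y in setT] 0.
Proof. by move=> _ [y _ <-]; rewrite addr_ge0 ?capped_ge0// mulr_ge0// mdist_ge0. Qed.

Lemma lipreg_le m x y : lipreg m x <= capped m y + m%:R * mdist x y.
Proof. by apply: ge_inf; [exists 0; exact: lbnd|exists y]. Qed.

Lemma le_lipreg m x z : (forall y, z <= capped m y + m%:R * mdist x y) ->
  z <= lipreg m x.
Proof.
move=> H; apply: lb_le_inf; first by exists (capped m x + m%:R * mdist x x), x.
by move=> _ [y _ <-].
Qed.

Lemma lipreg_ge0 m x : 0 <= lipreg m x.
Proof. by apply: le_lipreg => y; apply: lbnd; exists y. Qed.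

Lemma lipreg_le_capped m x : lipreg m x <= capped m x.
Proof. by have := lipreg_le m x x; rewrite mdistxx mulr0 addr0. Qed.

Lemma lipreg_le_fun m x : ((lipreg m x)%:E <= G x)%E.
Proof.
apply: (@le_trans _ _ (capped m x)%:E); first by rewrite lee_fin lipreg_le_capped.
by rewrite cappedE ge_min lexx.
Qed.

Lemma lipreg_bounded m x : lipreg m x <= m%:R.
Proof. exact: le_trans (lipreg_le_capped m x) (capped_le m x). Qed.

Lemma lipreg_lip m x y : `|lipreg m x - lipreg m y| <= m%:R * mdist x y.
Proof.
suff H u v : lipreg m u <= lipreg m v + m%:R * mdist u v.
  rewrite ler_norml; have := H x y; have := H y x; rewrite (metric_sym y x).
  by move=> h1 h2; apply/andP; split; lra.
rewrite -lerBlDr; apply: le_lipreg => z; rewrite lerBlDr.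
apply: le_trans (lipreg_le m u z) _; rewrite -addrA lerD2l -mulrDr ler_wpM2l//.
by rewrite addrC metric_triangle.
Qed.

Lemma lipreg_nd x : {homo lipreg ^~ x : m n / (m <= n)%N >-> m <= n}.
Proof.
move=> m n mn; apply: le_lipreg => y; apply: le_trans (lipreg_le m x y) _.
apply: lerD; last by rewrite ler_wpM2r ?mdist_ge0// ler_nat.
by rewrite -lee_fin !cappedE le_min2// lee_fin ler_nat.
Qed.

(** At a point where a lower semicontinuous function exceeds [a], it exceeds [a]
    on a ball; once the slope is large enough, points outside that ball do not
    matter either. *)
Lemma lipreg_sup x : lower_semicontinuous G ->
  (G x <= ereal_sup (range (fun m => (lipreg m x)%:E)))%E.
Proof.
move=> scG; set S := ereal_sup _.
have S0 : (0 <= S)%E.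
  apply: (@le_trans _ _ (lipreg 0 x)%:E); first by rewrite lee_fin lipreg_ge0.
  by apply: ereal_sup_ubound; exists 0%N.
have key (a : R) : 0 <= a -> (a%:E < G x)%E -> (a%:E <= S)%E.
  move=> a0 aG; have [V nV HV] := scG x a aG.
  move: nV; rewrite -filter_from_ballE => -[d /= d0 dV].
  have [m Hm] : exists m : nat, a + a / d < m.+1%:R.
    by exists (Num.truncn (a + a / d)); exact: truncnS_gt.
  have ad : 0 <= a / d by rewrite divr_ge0// ltW.
  apply: (@le_trans _ _ (lipreg m.+1 x)%:E); last first.
    by apply: ereal_sup_ubound; exists m.+1.
  rewrite lee_fin; apply: le_lipreg => y.
  have [xy|xy] := ltP (mdist x y) d.
    apply: ler_wpDr; first by rewrite mulr_ge0// mdist_ge0.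
    rewrite -lee_fin cappedE le_min (ltW (HV y _))/=; last first.
      by apply: dV; rewrite ballEmdist.
    rewrite lee_fin; lra.
  apply: ler_wpDl; first exact: capped_ge0.
  have h1 : a / d * d <= m.+1%:R * mdist x y.
    by apply: ler_pM => //; [exact: ltW|lra].
  by apply: le_trans h1; rewrite divfK// gt_eqF.
have [Gfin|] := boolP (G x \is a fin_num); last first.
  move=> Ginf; have Goo : G x = +oo%E by move: Ginf (G0 x); case: (G x).
  rewrite Goo; suff -> : S = +oo%E by [].
  apply/eqyP => A A0; apply: key; first exact: ltW.
  by rewrite Goo ltry.
have E : G x = (fine (G x))%:E by rewrite fineK.
rewrite E; apply/lee_subgt0Pr => e e0; rewrite -EFinB.
have [h|h] := leP (fine (G x) - e) 0; first by apply: le_trans S0; rewrite lee_fin.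
by apply: key; [exact: ltW|rewrite E lte_fin; lra].
Qed.

Lemma lipreg_lower_bound (b : X) (r c : R) : 0 < c ->
  (forall x, mdist b x < r + 1 -> (c%:E <= G x)%E) ->
  forall x, mdist b x < r -> Num.min c 1 <= lipreg 1 x.
Proof.
move=> c0 H x xr; apply: le_lipreg => y; rewrite mul1r.
have [xy|xy] := ltP (mdist x y) 1.
  apply: ler_wpDr; first exact: mdist_ge0.
  rewrite -lee_fin cappedE EFin_min le_min2// H//.
  by apply: le_lt_trans (metric_triangle _ x _) _; lra.
by apply: ler_wpDl; [exact: capped_ge0|rewrite ge_min xy orbT].
Qed.
End lipschitz_regularization.

Section lipschitz_minorants.
Context {R : realType} {X : pmetricType R}.
Context (mu : {measure set (borel X) -> \bar R}) (b : X) (p : R).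
Context (mufin : forall n : nat, (mu (ball b n%:R) < +oo)%E) (p_gt0 : 0 < p).

Let poweRK (x : \bar R) : (0 <= x)%E -> ((x `^ p^-1) `^ p = x)%E.
Proof. by move=> x0; rewrite -poweRrM mulVf ?gt_eqF// poweRe1. Qed.

Let poweRKV (x : \bar R) : (0 <= x)%E -> ((x `^ p) `^ p^-1 = x)%E.
Proof. by move=> x0; rewrite -poweRrM mulfV ?gt_eqF// poweRe1. Qed.

Let le_poweR (q : R) (x y : \bar R) : 0 <= q -> (0 <= x)%E -> (x <= y)%E ->
  (x `^ q <= y `^ q)%E.
Proof.
move=> q0 x0 xy; have y0 := le_trans x0 xy.
by apply: gt0_ler_poweR; rewrite ?in_itv/= ?x0 ?y0 ?leey.
Qed.

Lemma lsc_root (F : X -> \bar R) : (forall x, 0 <= F x)%E ->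
  lower_semicontinuous F -> lower_semicontinuous (fun x => F x `^ p^-1)%E.
Proof.
move=> F0 scF x a aF; have pV0 : 0 <= p^-1 by rewrite invr_ge0 ltW.
have [a0|a0] := ltP a 0.
  exists setT; first exact: filterT.
  by move=> y _; apply: lt_le_trans (poweR_ge0 _ _); rewrite lte_fin.
have [|V nV HV] := scF x (a `^ p).
  rewrite ltNge; apply/negP => h; move: aF; apply/negP; rewrite -leNgt.
  rewrite -[leRHS]poweRKV ?lee_fin// poweR_EFin; exact: le_poweR pV0 (F0 x) h.
exists V => // y /HV h; rewrite ltNge; apply/negP => h'.
move: h; apply/negP; rewrite -leNgt -poweR_EFin -[leLHS]poweRK//.
by apply: le_poweR => //; [exact: ltW|exact: poweR_ge0].
Qed.

(** Adding a small integrable function that is bounded below on balls keeps the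
    minorants away from zero on bounded sets. *)
Lemma lipschitz_minorants (g : X -> \bar R) (e : R) : nonneg_borel g -> 0 < e ->
  exists h : nat -> X -> R, [/\
    forall m x, 0 <= h m x /\ h m x <= m%:R,
    forall m x y, `|h m x - h m y| <= m%:R * mdist x y,
    forall x, {homo h ^~ x : m n / (m <= n)%N >-> m <= n} /\
      (g x <= ereal_sup (range (fun m => (h m x)%:E)))%E,
    forall m, (\int[mu]_x ((EFin \o h m) x `^ p) <=
       \int[mu]_x (g x `^ p) + e%:E)%E &
    forall n : nat, exists2 c, 0 < c & forall x, mdist b x < n%:R -> c <= h 1%N x].
Proof.
move=> [g0 mg] e0; have e20 : 0 < e / 2 by lra.
pose a (n : nat) := e / 2 / (2 ^ n.+1)%:R / (fine (mu (ball b n%:R)) + 1).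
have mun n : 0 <= fine (mu (ball b n%:R)) by exact: fine_ge0.
have a0 n : 0 < a n.
  by rewrite !divr_gt0 ?ltr0n ?expn_gt0//; have := mun n; lra.
have mb (n : nat) : measurable (ball b n%:R : set (borel X)) by exact: ball_borel.
have mi n : measurable_fun setT
    (fun x : borel X => (\1_(ball b n%:R) x)%:E : \bar R).
  by apply/measurable_EFinP; have := mb n; exact: measurable_indic.
have maj n : lsc_majorizable mu (fun x => (a n * \1_(ball b n%:R) x)%:E).
  by apply: (lsc_majorizable_indic (b := b)) => //; exact: ltW.
pose w x := (\sum_(0 <= n <oo) (a n * \1_(ball b n%:R) x)%:E)%E.
have Wmaj : lsc_majorizable mu w.
  exact: (lsc_majorizable_series (mu := mu)).
have gmaj : lsc_majorizable mu (fun x => g x `^ p)%E.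
  apply: (vitali_caratheodory (b := b)) => //; split.
    by move=> x; exact: poweR_ge0.
  exact: (measurableT_comp (measurable_poweR _)).
have [F0 mF Hmaj] := lsc_majorizableD gmaj Wmaj.
have [F [scF fF IF]] := Hmaj _ e20.
have wint : (\int[mu]_x w x <= (e / 2)%:E)%E.
  rewrite integral_nneseries//; last 2 first.
  - by move=> n; case: (maj n).
  - by move=> n x _; rewrite lee_fin mulr_ge0// ltW.
  apply: le_trans (epsilon_trick0 xpredT (ltW e20)).
  apply: lee_nneseries => n _.
    by move=> _; apply: integral_ge0 => x _; rewrite lee_fin mulr_ge0// ltW.
  under eq_integral do rewrite EFinM.
  rewrite ge0_integralZl//; last by rewrite lee_fin ltW.
    rewrite integral_indic// setIT -(@fineK _ (mu _)); last first.
      by rewrite ge0_fin_numE.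
    rewrite -EFinM lee_fin /a mulrAC ler_pdivrMr; last by have := mun n; lra.
    by rewrite ler_pM2l ?divr_gt0 ?ltr0n ?expn_gt0//; lra.
have Fge0 x : (0 <= F x)%E by apply: le_trans (fF x).
pose G x := (F x `^ p^-1)%E.
have G0 x : (0 <= G x)%E by exact: poweR_ge0.
have pV0 : 0 <= p^-1 by rewrite invr_ge0 ltW.
exists (lipreg G); split.
- by move=> m x; rewrite lipreg_ge0// lipreg_bounded.
- exact: lipreg_lip.
- move=> x; split; first exact: lipreg_nd.
  apply: le_trans (lipreg_sup G0 x (lsc_root Fge0 scF)).
  rewrite -[leLHS]poweRKV//; apply: le_poweR => //; first exact: poweR_ge0.
  apply: le_trans (fF x); rewrite leeDl//; case: Wmaj => + _ _; exact.
- move=> m; apply: (@le_trans _ _ (\int[mu]_x F x)%E).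
    apply: ge0_le_integral => //.
    + by move=> x _; exact: poweR_ge0.
    + apply: (measurableT_comp (measurable_poweR _)) => //.
      have [_ + ] := lipschitz_nonneg_borel (ler0n _ m) (lipreg_lip G0 m)
        (lipreg_ge0 G0 m).
      exact.
    + exact: lower_semicontinuous_borel.
    + move=> x _; rewrite -[leRHS]poweRK//; apply: le_poweR; first exact: ltW.
        by rewrite lee_fin lipreg_ge0.
      exact: lipreg_le_fun.
  apply: le_trans IF _; rewrite {2}(splitr e) EFinD addeA leeD2r//.
  rewrite ge0_integralD//=.
  + by rewrite leeD2l.
  + by move=> x _; exact: poweR_ge0.
  + by case: gmaj.
  + by move=> x _; case: Wmaj => + _ _; exact.
  + by case: Wmaj.
- move=> n; exists (Num.min ((a n.+1) `^ p^-1) 1); first by rewrite lt_min powR_gt0/=.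
  apply: (lipreg_lower_bound G0); first exact: powR_gt0.
  move=> x xn; rewrite -poweR_EFin; apply: le_poweR => //.
    by rewrite lee_fin ltW.
  apply: le_trans (fF x); rewrite -[leLHS]add0e; apply: leeD; first exact: poweR_ge0.
  have : (\sum_(0 <= k < n.+2) (a k * \1_(ball b k%:R) x)%:E <= w x)%E.
    by apply: nneseries_lim_ge => k _ _; rewrite lee_fin mulr_ge0// ltW.
  apply: le_trans; rewrite big_nat_recr//= indicE mem_set ?mulr1; last first.
    by rewrite ballEmdist/= -natr1.
  by rewrite leeDr// sume_ge0// => k _; rewrite lee_fin mulr_ge0// ltW.
Qed.
End lipschitz_minorants.

(** * Chain potentials *)

Section chains.
Context {R : realType} {X : pmetricType R}.
Context (g : X -> R) (E : set X) (d : R).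
Context (g0 : forall x, 0 <= g x).

Fixpoint chain_cost x (s : seq X) : R :=
  if s is y :: s' then g x * mdist x y + chain_cost y s' else 0.

Definition chain x (s : seq X) := path (fun y z : X => mdist y z < d) x s.

Definition chain_costs x : set R :=
  1 |` [set chain_cost x s | s in [set s | chain x s /\ E (last x s)]].

(** Least cost, cut at 1, of a chain of steps shorter than [d] from [x] to [E].
    Unlike an infimum over curves, it is continuous whenever [g] is bounded, so
    no measurability question arises. *)
Definition chain_potential x : R := inf (chain_costs x).

Lemma chain_cost_ge0 x s : 0 <= chain_cost x s.
Proof.
elim: s x => //= y s IH x; rewrite addr_ge0// mulr_ge0//; exact: mdist_ge0.
Qed.

Let lbound_costs x : lbound (chain_costs x) 0.
Proof. by move=> _ [->|[s _ <-]] //; exact: chain_cost_ge0. Qed.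

Lemma chain_potential_ge0 x : 0 <= chain_potential x.
Proof. by apply: lb_le_inf; [exists 1; left|exact: lbound_costs]. Qed.

Lemma chain_potential_le1 x : chain_potential x <= 1.
Proof. by apply: ge_inf; [exists 0; exact: lbound_costs|left]. Qed.

Lemma chain_potential_target x : E x -> chain_potential x = 0.
Proof.
move=> Ex; apply/eqP; rewrite eq_le chain_potential_ge0 andbT.
by apply: ge_inf; [exists 0; exact: lbound_costs|right; exists [::]].
Qed.

Lemma chain_potential_lt x e : chain_potential x < e -> e <= 1 ->
  exists s, [/\ chain x s, E (last x s) & chain_cost x s < e].
Proof.
move=> h e1; have [c [->|[s [cs Es] <-]] ce] : exists2 c, chain_costs x c & c < e.
- by apply: inf_lt => //; exists 1; left.
- by move: ce; rewrite ltNge e1.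
- by exists s.
Qed.

Lemma chain_potential_step x y : mdist x y < d ->
  chain_potential x <= g x * mdist x y + chain_potential y.
Proof.
move=> xy; rewrite -lerBlDl; apply: lb_le_inf; first by exists 1; left.
move=> _ [->|[s [cs Es] <-]]; rewrite lerBlDl.
  apply: le_trans (chain_potential_le1 x) _.
  by rewrite lerDr mulr_ge0// mdist_ge0.
apply: ge_inf; first by exists 0; exact: lbound_costs.
by right; exists (y :: s) => //=; rewrite /chain /= xy.
Qed.

Lemma chain_potential_grad K x y : 0 <= K ->
  (forall x y, `|g x - g y| <= K * mdist x y) -> mdist x y < d ->
  `|chain_potential x - chain_potential y| <= (g x + K * mdist x y) * mdist x y.
Proof.
move=> K0 glip xy; have yx : mdist y x < d by rewrite metric_sym.
have := chain_potential_step xy; have := chain_potential_step yx.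
rewrite (metric_sym y x) => h1 h2; have := glip x y; have d0 := mdist_ge0 x y.
rewrite !ler_norml => /andP[h3 h4].
have h5 : g y * mdist x y <= (g x + K * mdist x y) * mdist x y.
  by apply: ler_wpM2r => //; lra.
have h6 : g x * mdist x y <= (g x + K * mdist x y) * mdist x y.
  by apply: ler_wpM2r => //; rewrite lerDl mulr_ge0.
by apply/andP; split; lra.
Qed.

Lemma chain_potential_borel M : 0 < d -> (forall x, g x <= M) ->
  measurable_fun setT (EFin \o chain_potential : borel X -> \bar R).
Proof.
move=> d0 gM; apply: lower_semicontinuous_borel; apply: continuous_lsc => x e e0.
have M0 : 0 <= M := le_trans (g0 x) (gM x).
have M1 : 0 < M + 1 by lra.
exists (Num.min d (e / (M + 1))); first by rewrite lt_min d0 divr_gt0.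
move=> y; rewrite lt_min ltr_pdivlMr// => /andP[xy xye].
have yx : mdist y x < d by rewrite metric_sym.
have := chain_potential_step xy; have := chain_potential_step yx.
rewrite (metric_sym y x) => h1 h2; have D0 := mdist_ge0 x y.
have h3 : g y * mdist x y <= M * mdist x y by exact: ler_wpM2r.
have h4 : g x * mdist x y <= M * mdist x y by exact: ler_wpM2r.
by rewrite ltr_norml; apply/andP; split; lra.
Qed.
End chains.

(** * Telescoping the Poincare inequality *)

Section constants.
Context {R : realType} {X : pmetricType R}.
Context (mu : {measure set (borel X) -> \bar R}).

Definition doubling_with (C : R) := forall (x : X) (r : R), 0 < r ->
  [/\ (0 < mu (ball x (2 * r)%R))%E,
      (mu (ball x (2 * r)%R) <= C%:E * mu (ball x r))%E &
      (C%:E * mu (ball x r) < +oo)%E].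

Definition poincare_with (p C lambda : R) :=
  forall (x : X) (r : R) (u g : X -> \bar R), 0 < r ->
    mu_measurable mu u -> upper_gradient u g ->
    (average mu (fun y => `|u y - average mu u (ball x r)|) (ball x r) <=
    (C * r)%:E *
      (average mu (fun y => g y `^ p) (ball x (lambda * r)%R)) `^ p^-1)%E.
End constants.

Section poincare_step.
Context {R : realType} {X : pmetricType R}.
Context (mu : {measure set (borel X) -> \bar R}) (b : X) (p : R).
Context (Cmu Cp lambda : R) (Cp0 : 0 < Cp) (lambda1 : 1 <= lambda) (p_gt0 : 0 < p).
Context (dbl : doubling_with mu Cmu) (Cmu1 : 1 <= Cmu).
Context (poin : poincare_with mu p Cp lambda).

Definition vol r : R := fine (mu (ball b r)).

Lemma ball_gt0_fin x r : 0 < r -> (0 < mu (ball x r) < +oo)%E.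
Proof.
move=> r0; have [h1 _ h2] := dbl x r0.
have r20 : 0 < r / 2 by rewrite divr_gt0.
have [h3 _ _] := dbl x r20; move: h3; rewrite mulrC divfK// => -> /=.
apply: le_lt_trans h2; by rewrite -[leLHS]mul1e; apply: lee_wpmul2r.
Qed.

Lemma volE r : 0 < r -> mu (ball b r) = (vol r)%:E.
Proof.
move=> r0; rewrite /vol fineK// ge0_fin_numE//.
by have /andP[] := ball_gt0_fin b r0.
Qed.

Lemma vol_gt0 r : 0 < r -> 0 < vol r.
Proof. by move=> r0; rewrite -lte_fin -volE//; have /andP[] := ball_gt0_fin b r0. Qed.

Lemma vol_le r r' : 0 < r -> r <= r' -> vol r <= vol r'.
Proof.
move=> r0 rr'; rewrite -lee_fin -!volE//; last exact: lt_le_trans rr'.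
by apply: le_measure; rewrite ?inE; [exact: ball_borel..|exact: le_ball].
Qed.

Lemma vol_double r : 0 < r -> vol (2 * r) <= Cmu * vol r.
Proof.
move=> r0; rewrite -lee_fin EFinM -!volE//; last by rewrite mulr_gt0.
by have [_ + _] := dbl b r0.
Qed.

Section function.
Context (u g : X -> R) (A : R).
Context (u01 : forall x, 0 <= u x <= 1).
Context (mu_u : measurable_fun setT (EFin \o u : borel X -> \bar R)).
Context (ug : upper_gradient (EFin \o u) (EFin \o g)).
Context (intg : (\int[mu]_x ((EFin \o g) x `^ p) <= A%:E)%E).

Definition mean r : R := fine (average mu (EFin \o u) (ball b r)).

Let meas (v : X -> R) (D : set (borel X)) :
  measurable_fun setT (EFin \o v : borel X -> \bar R) ->
  measurable_fun D (fun x : borel X => (v x)%:E : \bar R).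
Proof. by move=> mv; exact: measurable_funTS mv. Qed.

Let u0 x : 0 <= u x. Proof. by have /andP[] := u01 x. Qed.
Let u1 x : u x <= 1. Proof. by have /andP[] := u01 x. Qed.

Lemma int_meanE r : 0 < r ->
  (\int[mu]_(x in ball b r) (u x)%:E = (mean r * vol r)%:E)%E.
Proof.
move=> r0; set I := (\int[mu]_(x in _) _)%E.
have I0 : (0 <= I)%E by apply: integral_ge0 => x _; rewrite lee_fin.
have IV : (I <= (vol r)%:E)%E.
  rewrite -volE// -[leRHS]mul1e -integral_cst; last exact: ball_borel.
  apply: ge0_le_integral.
  - exact: ball_borel.
  - by move=> x _; rewrite lee_fin.
  - exact: meas.
  - exact: measurable_cst.
  - by move=> x _; rewrite lee_fin.
have Ifin : I \is a fin_num by rewrite ge0_fin_numE// (le_lt_trans IV) ?ltry.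
rewrite /mean /average -/I fineM//= -/(vol r) mulrC mulrA divff ?mul1r ?fineK//.
by rewrite gt_eqF// vol_gt0.
Qed.

Lemma averageE r : 0 < r -> average mu (EFin \o u) (ball b r) = (mean r)%:E.
Proof.
move=> r0; rewrite /average -/(vol r) int_meanE// -EFinM; congr EFin.
by rewrite mulrC mulfK// gt_eqF// vol_gt0.
Qed.

(** Passing from [ball b (2 * r)] to [ball b r] multiplies the average of a
    nonnegative function by at most the doubling constant, and the Poincare
    inequality bounds the average oscillation over the larger ball. *)
Lemma mean_step r : 0 < r ->
  mean r <= mean (2 * r) + Cmu * (Cp * (2 * r)) * (A / vol (2 * r)) `^ p^-1.
Proof.
move=> r0; set r2 := 2 * r; have r20 : 0 < r2 by rewrite mulr_gt0.
have pV0 : 0 <= p^-1 by rewrite invr_ge0 ltW.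
have mg : measurable_fun setT (fun x : borel X => ((EFin \o g) x `^ p)%E).
  by apply: (measurableT_comp (measurable_poweR _)); case: ug => -[].
have mu_u' : mu_measurable mu (EFin \o u) by exists (EFin \o u) => //; exact: aeW.
have := poin b r20 mu_u' ug; rewrite averageE//.
set c := mean r2; set Q := (Cp * r2) * (A / vol r2) `^ p^-1.
have mabs : measurable_fun setT (fun x : borel X => `|u x - c|%:E : \bar R).
  have := mu_u; move=> /measurable_EFinP mur; apply/measurable_EFinP.
  by apply: (measurableT_comp (@normr_measurable R setT)); exact: measurable_funB.
have A0 : 0 <= A.
  by rewrite -lee_fin; apply: le_trans intg; apply: integral_ge0 => x _; exact: poweR_ge0.
have gavg : (average mu (fun y => (EFin \o g) y `^ p) (ball b (lambda * r2)) <=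
    (A / vol r2)%:E)%E.
  have rl : r2 <= lambda * r2 by rewrite ler_peMl// ltW.
  have rl0 : 0 < lambda * r2 by exact: lt_le_trans rl.
  rewrite /average -/(vol _) [A / _]mulrC EFinM; apply: lee_pmul.
  - by rewrite lee_fin invr_ge0 ltW// vol_gt0.
  - by apply: integral_ge0 => x _; exact: poweR_ge0.
  - by rewrite lee_fin lef_pV2 ?posrE ?vol_gt0// vol_le.
  - apply: le_trans intg; apply: ge0_subset_integral => //.
    + exact: ball_borel.
    + by move=> x _; exact: poweR_ge0.
have rhs : ((Cp * r2)%:E * (average mu (fun y => (EFin \o g) y `^ p)
     (ball b (lambda * r2))) `^ p^-1 <= Q%:E)%E.
  rewrite /Q [leRHS]EFinM; apply: lee_wpmul2l; first by rewrite lee_fin mulr_ge0// ltW.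
  rewrite -poweR_EFin; apply: gt0_ler_poweR => //; rewrite ?in_itv/= ?leey ?andbT.
  + apply: mule_ge0; first by rewrite lee_fin invr_ge0; exact: fine_ge0.
    by apply: integral_ge0 => x _; rewrite lee_fin powR_ge0.
  + by rewrite lee_fin divr_ge0// ltW// vol_gt0.
move=> /le_trans/(_ rhs); rewrite /average -/(vol r2).
set J := (\int[mu]_(x in _) _)%E => JQ.
have JQ' : (J <= (vol r2 * Q)%:E)%E.
  rewrite EFinM -(@lee_pdivrMl _ (vol r2)) ?vol_gt0//.
have Jr : (\int[mu]_(x in ball b r) `|u x - c|%:E <= J)%E.
  apply: ge0_subset_integral => //.
  + exact: ball_borel.
  + exact: ball_borel.
  + exact: measurable_funTS mabs.
  + by apply: le_ball; rewrite /r2; lra.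
have c0 : 0 <= c.
  apply: fine_ge0; apply: mule_ge0; first by rewrite lee_fin invr_ge0 fine_ge0.
  by apply: integral_ge0 => x _; rewrite lee_fin.
have main : ((mean r * vol r)%:E <= (vol r2 * Q + c * vol r)%:E)%E.
  rewrite -int_meanE//; apply: (@le_trans _ _ (\int[mu]_(x in ball b r)
     (`|u x - c|%:E + c%:E))%E).
    apply: ge0_le_integral.
    - exact: ball_borel.
    - by move=> x _; rewrite lee_fin.
    - exact: meas.
    - apply: emeasurable_funD; [exact: measurable_funTS mabs|exact: measurable_cst].
    - by move=> x _; rewrite -EFinD lee_fin -lerBlDr ler_norm.
  rewrite ge0_integralD//.
  - rewrite integral_cst; last exact: ball_borel.
    by rewrite /= volE// -EFinM EFinD leeD2r// (le_trans Jr).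
  - exact: ball_borel.
  - exact: measurable_funTS mabs.
rewrite lee_fin in main.
have V0 := vol_gt0 r0; have Q0 : 0 <= Q.
  by rewrite mulr_ge0 ?powR_ge0// mulr_ge0// ltW.
have h1 : vol r2 * Q <= Cmu * vol r * Q by apply: ler_wpM2r => //; exact: vol_double.
rewrite -mulrA -/Q -(@ler_pM2r _ (vol r))//.
lra.
Qed.

End function.
End poincare_step.

Section telescoping.
Context {R : realType} {X : pmetricType R}.
Context (mu : {measure set (borel X) -> \bar R}) (b : X) (p : R).
Context (Cmu Cp lambda : R) (Cp0 : 0 < Cp) (lambda1 : 1 <= lambda) (p_gt1 : 1 < p).
Context (dbl : doubling_with mu Cmu) (Cmu1 : 1 <= Cmu).
Context (poin : poincare_with mu p Cp lambda).
Context (r0 c q : R) (r0_gt0 : 0 < r0) (c_gt0 : 0 < c) (p_lt_q : p < q).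
Context (growth : forall r, r0 <= r -> c * r `^ q <= vol mu b r).
Context (u g : X -> R) (A : R).
Context (u01 : forall x, 0 <= u x <= 1).
Context (mu_u : measurable_fun setT (EFin \o u : borel X -> \bar R)).
Context (ug : upper_gradient (EFin \o u) (EFin \o g)).
Context (intg : (\int[mu]_x ((EFin \o g) x `^ p) <= A%:E)%E).
Context (rho : R) (rho_gt0 : 0 < rho) (u_out : forall x, ~ ball b rho x -> u x = 0).

Let p_gt0 : 0 < p. Proof. exact: lt_trans p_gt1. Qed.
Let q_gt1 : 1 < q. Proof. exact: lt_trans p_lt_q. Qed.
Let vpos r : 0 < r -> 0 < vol mu b r.
Proof. exact: (vol_gt0 b dbl Cmu1). Qed.
Let s := 1 - q / p.
Let tau := 2 `^ s.
Let D := Cmu * Cp * r0 `^ s * (A / c) `^ p^-1.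
Let rad j := 2 ^+ j * r0.

Let A0 : 0 <= A.
Proof.
by rewrite -lee_fin; apply: le_trans intg; apply: integral_ge0 => x _; exact: poweR_ge0.
Qed.

Let s_lt0 : s < 0.
Proof. by rewrite subr_lt0 ltr_pdivlMr// mul1r. Qed.

Let tau_gt0 : 0 < tau. Proof. exact: powR_gt0. Qed.

Let tau_lt1 : tau < 1.
Proof.
have s1 : 0 < - s by rewrite oppr_gt0.
rewrite /tau -[s]opprK powRN invf_lt1 ?powR_gt0//.
have := @gt0_ltr_powR _ _ s1 1 2; rewrite powR1; apply; rewrite ?nnegrE//.
by rewrite ltr1n.
Qed.

Let rad_gt0 j : 0 < rad j. Proof. by rewrite mulr_gt0// exprn_gt0. Qed.

Let rad_ge j : r0 <= rad j.
Proof. by rewrite ler_peMl ?(ltW r0_gt0)// exprn_ege1// ler1n. Qed.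

Let step j : mean mu b u (rad j) <= mean mu b u (rad j.+1) + D * tau ^+ j.+1.
Proof.
have := mean_step b Cp0 lambda1 p_gt0 dbl Cmu1 poin u01 mu_u ug intg (rad_gt0 j).
have -> : 2 * rad j = rad j.+1 by rewrite /rad exprS mulrA.
move=> /le_trans; apply; rewrite lerD2l /D.
have tE : rad j.+1 = 2 ^+ j.+1 * r0 by [].
have t0 := rad_gt0 j.+1; have t_ge := rad_ge j.+1.
move: (rad j.+1) tE t0 t_ge => t tE t0 t_ge.
rewrite -!mulrA ler_wpM2l ?(le_trans ler01)// ler_wpM2l ?(ltW Cp0)//.
have cq : 0 < c * t `^ q by rewrite mulr_gt0// powR_gt0.
(* The volume is at least [c * t `^ q], and [t * (t `^ q) `^ (- p^-1) = t `^ s]. *)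
have AV : A / vol mu b t <= A / c * (t `^ q)^-1.
  by rewrite -mulrA ler_wpM2l// -invfM lef_pV2 ?posrE ?vpos ?growth.
have pV : 0 <= p^-1 by rewrite invr_ge0 ltW.
apply: (@le_trans _ _ (t * ((A / c) * (t `^ q)^-1) `^ p^-1)).
  rewrite ler_wpM2l ?(ltW t0)//; apply: ge0_ler_powR => //.
    by rewrite nnegrE divr_ge0// ltW//; exact: vpos.
  by rewrite nnegrE mulr_ge0 ?invr_ge0 ?powR_ge0// divr_ge0// ltW.
rewrite powRM ?invr_ge0 ?powR_ge0 ?divr_ge0 ?(ltW c_gt0)//.
rewrite -powRN -powRrM.
have -> : tau ^+ j.+1 = (2 ^+ j.+1) `^ s.
  by rewrite -powR_mulrn ?(ltW tau_gt0)// /tau -powRAC powR_mulrn.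
rewrite [r0 `^ s * _]mulrCA [r0 `^ s * _]mulrC -powRM ?exprn_ge0 ?(ltW r0_gt0)//.
rewrite -tE mulrCA ler_wpM2l ?powR_ge0//.
rewrite -{1}[t]powRr1 ?(ltW t0)// -powRD ?(gt_eqF t0) ?implybT//.
by rewrite /s mulNr.
Qed.

Let telescope j : mean mu b u r0 <=
  mean mu b u (rad j) + D * (tau - tau ^+ j.+1) / (1 - tau).
Proof.
have t1 : 1 - tau != 0 by rewrite subr_eq0 eq_sym lt_eqF.
elim: j => [|j IH]; first by rewrite expr1 subrr mulr0 mul0r addr0 /rad mul1r.
apply: le_trans IH _; apply: le_trans (lerD (step j) (lexx _)) _.
rewrite -addrA lerD2l le_eqVlt; apply/orP; left; apply/eqP.
by rewrite [tau ^+ j.+2]exprSr; field.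
Qed.

Let vanish e : 0 < e -> exists j, mean mu b u (rad j) <= e.
Proof.
move=> e0; pose V := vol mu b rho.
have V0 : 0 < V by exact: vpos.
have ce0 : 0 < c * e by rewrite mulr_gt0.
pose B := (1 + V / (c * e)) / r0.
exists (Num.truncn B); set j := Num.truncn B.
have Br : 1 + V / (c * e) <= rad j.
  rewrite /rad -ler_pdivrMr//; apply: (@le_trans _ _ j.+1%:R); first exact/ltW/truncnS_gt.
  by rewrite -natrX ler_nat ltn_expl.
have VC : 0 < V / (c * e) by rewrite divr_gt0.
have Vle : V <= vol mu b (rad j) * e.
  have h : rad j <= rad j `^ q by apply: le1r_powR; [lra|exact: ltW].
  apply: le_trans (_ : c * rad j * e <= _); last first.
    rewrite ler_wpM2r ?(ltW e0)//; apply: le_trans (growth (rad_ge j)).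
    by rewrite ler_wpM2l ?(ltW c_gt0).
  rewrite mulrAC [leRHS]mulrC -ler_pdivrMr//; lra.
rewrite -(@ler_pM2r _ (vol mu b (rad j))); last exact: vpos.
rewrite [leRHS]mulrC; apply: le_trans Vle.
rewrite -lee_fin -(int_meanE b dbl Cmu1 u01 mu_u)// /V -(volE b dbl Cmu1)//.
rewrite -[leRHS]mul1e -integral_cst; last exact: ball_borel.
rewrite [leLHS]integral_mkcond [leRHS]integral_mkcond.
apply: ge0_le_integral => //.
- by move=> x _; apply: erestrict_ge0 => y _; rewrite lee_fin; case/andP: (u01 y).
- apply/(measurable_restrictT _ (ball_borel _ _)).
  exact: measurable_funTS mu_u.
- by apply/(measurable_restrictT _ (ball_borel _ _)); exact: measurable_cst.
move=> x _; rewrite /patch; have [xr|xr] := pselect (ball b rho x).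
  by rewrite (mem_set xr); case: ifP => _; rewrite lee_fin; case/andP: (u01 x).
rewrite u_out// (memNset xr).
by case: ifP.
Qed.

(** The volume growth turns the errors of the successive comparisons of means
    over [ball b (2 ^+ j * r0)] into a geometric series, and the means tend to
    zero since [u] has bounded support while the volume is infinite. *)
Lemma mean_le_energy : mean mu b u r0 <=
  Cmu * Cp * r0 `^ (1 - q / p) / (1 - 2 `^ (1 - q / p)) * (A / c) `^ p^-1.
Proof.
have D0 : 0 <= D.
  by rewrite !mulr_ge0 ?powR_ge0 ?(ltW Cp0)// (le_trans ler01).
have t1 : 0 < 1 - tau by rewrite subr_gt0.
apply/ler_addgt0Pr => e /vanish[j Hj]; apply: le_trans (telescope j) _.
rewrite addrC lerD//.
have -> : Cmu * Cp * r0 `^ (1 - q / p) / (1 - 2 `^ (1 - q / p)) * (A / c) `^ p^-1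
    = D * 1 / (1 - tau) by rewrite /D -/s -/tau; ring.
rewrite ler_wpM2r ?invr_ge0 ?(ltW t1)// ler_wpM2l//.
by have := exprn_gt0 j.+1 tau_gt0; have := tau_lt1; lra.
Qed.
End telescoping.

(** * Walks along chains *)

Section walks.
Context {R : realType} {X : pmetricType R}.
Context (G g : X -> R) (K d : R).
Context (g0 : forall x, 0 <= g x) (gG : forall x, g x <= G x) (K0 : 0 <= K).
Context (glip : forall x y, `|g x - g y| <= K * mdist x y) (d0 : 0 < d).

Fixpoint chain_length (x : X) (s : seq X) : R :=
  if s is y :: s' then mdist x y + chain_length y s' else 0.

(** The point that a traveller along the chain at unit speed has last visited
    at time [t], and the cost paid so far. *)
Fixpoint walk (x : X) (s : seq X) (t : R) : X :=
  if s is y :: s' then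
    if mdist x y <= t then walk y s' (t - mdist x y) else x
  else x.

Fixpoint walk_cost (x : X) (s : seq X) (t : R) : R :=
  if s is y :: s' then
    if mdist x y <= t then G x * mdist x y + walk_cost y s' (t - mdist x y) else 0
  else 0.

Let G0 x : 0 <= G x. Proof. exact: le_trans (gG x). Qed.

Lemma mdist_le_chain_length x s : mdist x (last x s) <= chain_length x s.
Proof.
elim: s x => [|y s IH] x /=; first by rewrite mdistxx.
by apply: le_trans (metric_triangle _ y _) _; rewrite lerD2l.
Qed.

Lemma walk_cost_ge0 x s t : 0 <= walk_cost x s t.
Proof.
elim: s x t => //= y s IH x t; case: ifP => // _.
by rewrite addr_ge0// mulr_ge0// mdist_ge0.
Qed.

Lemma walk_cost_le x s t : walk_cost x s t <= chain_cost G x s.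
Proof.
elim: s x t => //= y s IH x t; case: ifP => _; first by rewrite lerD2l.
by rewrite addr_ge0// ?chain_cost_ge0// mulr_ge0// mdist_ge0.
Qed.

Lemma mdist_walk x s t : 0 <= t -> mdist x (walk x s t) <= t.
Proof.
elim: s x t => [|y s IH] x t t0 /=; first by rewrite mdistxx.
case: ifP => [xy|_]; last by rewrite mdistxx.
apply: le_trans (metric_triangle _ y _) _.
have := IH y (t - mdist x y); rewrite subr_ge0 => /(_ xy); lra.
Qed.

Lemma walk_lip x s t t' : chain d x s -> 0 <= t -> t <= t' ->
  mdist (walk x s t) (walk x s t') <= t' - t + d.
Proof.
elim: s x t t' => [|y s IH] x t t' /=.
  by move=> _ _ tt'; rewrite mdistxx addr_ge0 ?subr_ge0// ltW.
move=> /andP[xy cs] t0 tt'; case: ifP => [h|/negbT h].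
  rewrite (le_trans h tt').
  have := IH y (t - mdist x y) (t' - mdist x y) cs.
  rewrite subr_ge0 lerB// => /(_ h isT); lra.
rewrite -ltNge in h.
by have := @mdist_walk x (y :: s) t' (le_trans t0 tt') => /=; lra.
Qed.

(** Up to time [t] the walk stays within [c + t] of [z], where [g] is at least
    [g z - K * (c + t)], and the steps completed by then have a total length of at
    least [t - d]. *)
Lemma walk_cost_from_start z x s t c : chain d x s -> 0 <= t ->
  t <= chain_length x s -> 0 <= g z - K * (c + t) -> mdist z x <= c ->
  (g z - K * (c + t)) * (t - d) <= walk_cost x s t.
Proof.
elim: s x t c => [|y s IH] x t c /=.
  move=> _ t0 tl C0 _; rewrite mulr_ge0_le0//.
  by have d0' := d0; lra.
move=> /andP[xy cs] t0 tl C0 zx; set C := g z - _ in C0 *.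
case: ifP => [h|/negbT h]; last first.
  by rewrite -ltNge in h; rewrite mulr_ge0_le0//; lra.
have h1 : (g z - K * (c + mdist x y + (t - mdist x y))) = C.
  by rewrite /C; ring.
have := IH y (t - mdist x y) (c + mdist x y) cs.
rewrite h1 subr_ge0 h => /(_ isT) H.
have {}H : C * (t - mdist x y - d) <= walk_cost y s (t - mdist x y).
  apply: H => //; first by lra.
  by apply: le_trans (metric_triangle _ x _) _; rewrite lerD2r.
have h2 : C * mdist x y <= G x * mdist x y.
  apply: ler_wpM2r; first exact: mdist_ge0.
  apply: le_trans (gG x); have := glip z x; rewrite ler_norml => /andP[_ h3].
  have h4 : K * mdist z x <= K * c by rewrite ler_wpM2l.
  have h5 : 0 <= K * t by rewrite mulr_ge0.
  by rewrite /C mulrDr; lra.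
lra.
Qed.

Lemma walk_cost_nd x s t t' : t <= t' -> walk_cost x s t <= walk_cost x s t'.
Proof.
elim: s x t t' => //= y s IH x t t' tt'.
case: ifP => h; first by rewrite (le_trans h tt') lerD2l; apply: IH; rewrite lerB.
case: ifP => // _; rewrite addr_ge0 ?walk_cost_ge0// mulr_ge0//.
exact: mdist_ge0.
Qed.

(** The vertex occupied at time [t] was reached less than [d] earlier, and the
    walk can be restarted there. *)
Lemma walk_cost_increment x s t t' : chain d x s -> 0 <= t ->
  t' <= chain_length x s -> d <= t' - t ->
  (g (walk x s t) - K * (t' - t + d)) * (t' - t - d) <=
  walk_cost x s t' - walk_cost x s t.
Proof.
move=> cs t0 t'l dt; have d0' := d0; have K0' := K0.
have [C0|C0] := leP 0 (g (walk x s t) - K * (t' - t + d)); last first.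
  apply: (@le_trans _ _ 0); first by rewrite nmulr_rle0// subr_ge0.
  by rewrite subr_ge0 walk_cost_nd//; lra.
elim: s x t t' cs t0 t'l dt C0 => [|y s IH] x t t' /=.
  by move=> _ t0 t'0 dt; lra.
move=> /andP[xy cs] t0 t'l dt; have tt' : t <= t' by lra.
case: ifP => [h|/negbT h] C0.
  have h' := le_trans h tt'; rewrite h'.
  have e1 : t' - mdist x y - (t - mdist x y) = t' - t by ring.
  have := IH y (t - mdist x y) (t' - mdist x y) cs.
  rewrite e1 subr_ge0 h => /(_ isT) H.
  have H2 : t' - mdist x y <= chain_length y s by lra.
  by have := H H2 dt C0; lra.
rewrite -ltNge in h; rewrite subr0.
have cs' : chain d x (y :: s) by rewrite /chain /= xy.
have le1 : K * t' <= K * (t' - t + d) by rewrite ler_wpM2l//; lra.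
have le2 : g x - K * (t' - t + d) <= g x - K * (0 + t') by lra.
have t'0 : 0 <= t' by lra.
have zx : mdist x x <= 0 by rewrite mdistxx.
apply: le_trans (walk_cost_from_start cs' t'0 t'l (le_trans C0 le2) zx).
by apply: ler_pM => //; lra.
Qed.
End walks.

(** * Compactness from doubling *)

Section total_boundedness.
Context {R : realType} {X : pmetricType R}.
Context (mu : {measure set (borel X) -> \bar R}) (Cmu : R).
Context (dbl : doubling_with mu Cmu) (Cmu1 : 1 <= Cmu).

Let volume x r : R := vol mu x r.

Lemma vol_pow x r m : 0 < r -> volume x (2 ^+ m * r) <= Cmu ^+ m * volume x r.
Proof.
move=> r0; elim: m => [|m IH]; first by rewrite !expr0 !mul1r.
rewrite !exprS -mulrA; apply: le_trans (vol_double x dbl Cmu1 _) _.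
  by rewrite mulr_gt0// exprn_gt0.
by rewrite -mulrA ler_wpM2l// (le_trans ler01).
Qed.

Definition net (e : R) (s : seq X) : set X :=
  [set z | exists2 y, y \in s & ball y e z].

Lemma net_open e s : open (net e s).
Proof.
rewrite (_ : net e s = \bigcup_(y in [set` s]) ball y e).
  by apply: bigcup_open => y _; exact: ball_open.
by apply/seteqP; split => z [y ys yz]; exists y.
Qed.

(** Disjoint balls of a fixed radius inside a fixed ball have volumes bounded
    below, so there are at most as many of them as the total volume allows. *)
Lemma separated_volume e v s : (forall y, y \in s -> v <= volume y (e / 2)) ->
  0 < e -> pairwise (fun y z : X => e <= mdist y z) s ->
  (((size s)%:R * v)%:E <= mu (net (e / 2) s))%E.
Proof.
move=> + e0; have e20 : 0 < e / 2 by rewrite divr_gt0.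
elim: s => [|y s IH] H /=; first by rewrite mul0r.
move=> /andP[ys sep].
have -> : net (e / 2) (y :: s) = ball y (e / 2) `|` net (e / 2) s.
  apply/seteqP; split => z.
    by move=> [w]; rewrite inE => /predU1P[->|ws] wz; [left|right; exists w].
  move=> [yz|[w ws wz]]; first by exists y; rewrite ?mem_head.
  by exists w => //; rewrite inE ws orbT.
rewrite measureU//; last 3 first.
- exact: ball_borel.
- by apply: open_borel; exact: net_open.
- rewrite -subset0 => z [yz [w ws wz]].
  move/allP : ys => /(_ w ws).
  move: yz wz; rewrite !ballEmdist/= => h1 h2.
  by have := metric_triangle y z w; rewrite (metric_sym z w); lra.
rewrite -natr1 mulrDl mul1r addrC EFinD; apply: leeD.
  have := H y (mem_head _ _); rewrite -lee_fin => /le_trans; apply.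
  by have := volE y dbl Cmu1 e20; rewrite /volume => <-.
by apply: IH => // w ws; apply: H; rewrite inE ws orbT.
Qed.

(** A separated set that cannot be enlarged is a net, and [separated_volume]
    bounds the size of separated sets. *)
Lemma doubling_totally_bounded x r e : 0 < r -> 0 < e ->
  exists s, ball x r `<=` net e s.
Proof.
move=> r0 e0; have e20 : 0 < e / 2 by rewrite divr_gt0.
have re0 : 0 < r + e by rewrite addr_gt0.
have [m Hm] : exists m : nat, 2 * r + e <= 2 ^+ m * (e / 2).
  exists (Num.truncn ((2 * r + e) / (e / 2))); rewrite -ler_pdivrMr//.
  set B := _ / _; apply: (@le_trans _ _ (Num.truncn B).+1%:R).
    exact/ltW/truncnS_gt.
  by rewrite -natrX ler_nat ltn_expl.
pose v := volume x (r + e) / Cmu ^+ m.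
have Cm0 : 0 < Cmu ^+ m by rewrite exprn_gt0// (lt_le_trans ltr01).
have v0 : 0 < v by rewrite divr_gt0//; exact: (vol_gt0 x dbl Cmu1).
have low y : ball x r y -> v <= volume y (e / 2).
  move=> xy; rewrite ler_pdivrMr// mulrC; apply: le_trans (vol_pow y m e20).
  rewrite -lee_fin -!(volE _ dbl Cmu1)//; last by rewrite mulr_gt0// exprn_gt0.
  apply: le_measure; rewrite ?inE; [exact: ball_borel..|].
  move=> z; move: xy; rewrite !ballEmdist/= => h1 h2.
  have := metric_triangle y x z; rewrite (metric_sym y x); lra.
have dicho n : (exists s, ball x r `<=` net e s) \/ exists s, [/\ size s = n,
    forall y, y \in s -> ball x r y & pairwise (fun y z : X => e <= mdist y z) s].
  elim: n => [|n [|[s [sn sx sep]]]]; [by right; exists [::]|by left|].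
  have [|H] := pselect (ball x r `<=` net e s); first by left; exists s.
  right; have [y [xy ny]] : exists y, ball x r y /\ ~ net e s y.
    apply: contrapT => h; apply: H => y xy; apply: contrapT => ny; apply: h.
    by exists y.
  exists (y :: s); split => /=; first by rewrite sn.
    by move=> z; rewrite inE => /predU1P[->|/sx].
  rewrite sep andbT; apply/allP => z zs; rewrite leNgt; apply/negP => yz.
  by apply: ny; exists z => //; rewrite ballEmdist/= metric_sym.
have [//|[s [sn sx sep]]] := dicho (Num.truncn (volume x (r + e) / v)).+1.
exfalso.
have := separated_volume (fun y ys => low y (sx y ys)) e0 sep.
have sub : (mu (net (e / 2) s) <= (volume x (r + e))%:E)%E.
  rewrite -(volE _ dbl Cmu1)//; apply: le_measure; rewrite ?inE.
  - by apply: open_borel; exact: net_open.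
  - exact: ball_borel.
  - move=> z [y /sx]; rewrite !ballEmdist/= => h1 h2.
    by apply: le_lt_trans (metric_triangle _ y _) _; lra.
move=> /le_trans/(_ sub); rewrite lee_fin sn -ler_pdivlMr// leNgt.
by rewrite truncnS_gt.
Qed.

Lemma ultra_net (I : Type) (U : set_system I) (f : I -> X) e s : UltraFilter U ->
  U (f @^-1` net e s) -> exists y, U (f @^-1` ball y e).
Proof.
move=> UU; elim: s => [|y s IH] h.
  have [i [y]] := filter_ex h; by rewrite in_nil.
have [|h'] := in_ultra_setVsetC (f @^-1` ball y e) UU; first by exists y.
apply: IH; apply: filterS (filterI h h') => i [[w]].
by rewrite inE => /predU1P[->//|ws] wi _; exists w.
Qed.

Lemma bounded_ultra_cvg (U : set_system nat) (f : nat -> X) x r : UltraFilter U ->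
  complete_space X -> 0 < r -> (\forall n \near U, ball x r (f n)) ->
  exists l : X, f n @[n --> U] --> l.
Proof.
move=> UU complete r0 fr; apply: complete; apply: cauchy_exP => e e0.
have [s Hs] := doubling_totally_bounded x r0 e0.
by apply: (@ultra_net nat U f e s UU); apply: filterS fr => n /Hs.
Qed.

Lemma real_ultra_cvg (U : set_system nat) (f : nat -> R) a b : UltraFilter U ->
  (forall n, a <= f n <= b) -> exists2 l : R, a <= l <= b & f n @[n --> U] --> l.
Proof.
move=> UU fab; have := @segment_compact R a b; rewrite compact_ultra /=.
move=> /(_ (f n @[n --> U])) [].
- split; first exact: fmap_proper_filter.
  move=> G PG sub; apply/seteqP; split => [A GA|]; last exact: sub.
  have [//|h] := in_ultra_setVsetC (f @^-1` A) UU.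
  have : G (~` A) by apply: sub; exact: h.
  by move=> /(filterI GA); rewrite setICr => /filter_not_empty.
- change (U (f @^-1` `[a, b])); apply: (filterS _ filterT) => n _.
  by rewrite /= in_itv/= fab.
- by move=> l []; rewrite /= in_itv/= => lab fl; exists l.
Qed.
End total_boundedness.

(** * The limit curve *)

Section limit_curve.
Context {R : realType} {X : pmetricType R}.
Context (mu : {measure set (borel X) -> \bar R}) (Cmu : R).
Context (dbl : doubling_with mu Cmu) (Cmu1 : 1 <= Cmu).
Context (complete : complete_space X).
Context (h : nat -> X -> R) (h0 : forall m x, 0 <= h m x).
Context (hlip : forall m x y, `|h m x - h m y| <= m%:R * mdist x y).
Context (hnd : forall x, {homo h ^~ x : m n / (m <= n)%N >-> m <= n}).
Context (b : X) (r : R) (r_gt0 : 0 < r) (kappa : R).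
Context (x_ : nat -> X) (s_ : nat -> seq X).
Context (x_near : forall k, mdist b (x_ k) < r).
Context (chain_s : forall k, chain k.+1%:R^-1 (x_ k) (s_ k)).
Context (cost_s : forall k, chain_cost (h k) (x_ k) (s_ k) < kappa).
Context (last_s : forall k, k%:R <= mdist b (last (x_ k) (s_ k))).

Let delta_gt0 k : 0 < k.+1%:R^-1 :> R. Proof. by rewrite invr_gt0 ltr0n. Qed.

Let long k : k%:R - r <= chain_length (x_ k) (s_ k).
Proof.
have h1 := mdist_le_chain_length (x_ k) (s_ k).
have h2 := metric_triangle b (x_ k) (last (x_ k) (s_ k)).
by have h3 := x_near k; have h4 := last_s k; lra.
Qed.

(** Nonprincipal ultrafilter limits of the walks and of their costs replace the
    extraction of convergent subsequences at countably many times. *)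
Lemma limit_curve : exists (phi : R -> X) (c : R -> R), [/\
  forall t t', t <= t' -> mdist (phi t) (phi t') <= t' - t,
  closure (ball b r) (phi 0),
  forall t, 0 <= c t <= kappa &
  forall m t t', 0 <= t -> t <= t' ->
    (h m (phi t) - m%:R * (t' - t)) * (t' - t) <= c t' - c t].
Proof.
have [U [UU sub]] := ultraFilterLemma (@eventually_filter).
have ev (P : nat -> Prop) : (\forall n \near \oo, P n) -> \forall n \near U, P n.
  by move=> HP; exact: sub.
(* Clamping the times makes the limit 1-Lipschitz on the whole line. *)
pose f t k := walk (x_ k) (s_ k) (Num.max 0 t).
pose C t k := walk_cost (h k) (x_ k) (s_ k) (Num.max 0 t).
have /choice[phi Hphi] : forall t, exists l : X, f t n @[n --> U] --> l.
  move=> t; have t0 : 0 <= Num.max 0 t by rewrite le_max lexx.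
  apply: (bounded_ultra_cvg dbl Cmu1 (x := b) (r := r + Num.max 0 t)) => //.
    by rewrite ltr_wpDr.
  apply: (filterS _ filterT) => k _ /=; rewrite ballEmdist/=.
  have h1 := mdist_walk (x_ k) (s_ k) t0.
  apply: le_lt_trans (metric_triangle _ (x_ k) _) _.
  by rewrite ltr_leD.
have /choice[c Hc] : forall t, exists l : R, 0 <= l <= kappa /\ C t n @[n --> U] --> l.
  move=> t; have [|l l0 Hl] := @real_ultra_cvg R U (C t) 0 kappa UU.
    move=> k; have hh x : h k x <= h k x by [].
    rewrite (walk_cost_ge0 (h0 k) hh)/=.
    exact: le_trans (walk_cost_le (h0 k) hh _ _ _) (ltW (cost_s k)).
  by exists l.
have delta_cvg : k.+1%:R^-1 @[k --> U] --> (0 : R).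
  by apply: cvg_trans (@cvg_harmonic R); exact: cvg_app sub.
have near_dist t e : 0 < e -> \forall n \near U, mdist (phi t) (f t n) < e.
  exact: metricType_numDomainType.cvgr_dist_lt.
exists phi, c; split.
- move=> t t' tt'; apply/ler_addgt0Pr => e e0; have e30 : 0 < e / 3 by lra.
  have e3 : \forall n \near U, n.+1%:R^-1 < e / 3.
    have /cvgrPdist_lt/(_ _ e30) := delta_cvg; apply: filterS => n.
    by rewrite sub0r normrN gtr0_norm.
  have [n [[h1 h2] h3]] := filter_ex (filterI (filterI (near_dist t _ e30)
    (near_dist t' _ e30)) e3).
  have {}h1 : mdist (phi t) (f t n) < e / 3 by exact: h1.
  have {}h2 : mdist (phi t') (f t' n) < e / 3 by exact: h2.
  have {}h3 : n.+1%:R^-1 < e / 3 by exact: h3.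
  have h4 : mdist (f t n) (f t' n) <= t' - t + n.+1%:R^-1.
    have mx : Num.max 0 t <= Num.max 0 t' by rewrite le_max2.
    apply: le_trans (walk_lip (delta_gt0 n) (chain_s n) _ mx) _.
      by rewrite le_max lexx.
    rewrite lerD2r; case: (leP 0 t) => t0; case: (leP 0 t') => t'0; lra.
  have h5 := metric_triangle (phi t) (f t n) (phi t').
  have h6 := metric_triangle (f t n) (f t' n) (phi t').
  rewrite (metric_sym (f t' n) (phi t')) in h6.
  by move: n.+1%:R^-1 h3 h4 => dn h3 h4; lra.
- move=> V /Hphi HV; have [n Vn] : exists n, V (f 0 n) by exact: (@filter_ex _ U).
  exists (f 0 n); split => //; rewrite ballEmdist/=.
  have := mdist_walk (x_ n) (s_ n) (lexx 0); rewrite /f max_l// => h1.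
  apply: le_lt_trans (metric_triangle _ (x_ n) _) _.
  by have := x_near n; lra.
- by move=> t; case: (Hc t).
- move=> m t t' t0 tt'.
  have [->|ne] := eqVneq t t'; first by rewrite !subrr mulr0.
  have lt : 0 < t' - t by rewrite subr_gt0 lt_neqAle ne.
  have hcvg : h m (f t n) @[n --> U] --> h m (phi t).
    have m1 : 0 < m%:R + 1 :> R by rewrite ltr_wpDl.
    apply/cvgrPdist_lt => e e0; have e1 : 0 < e / (m%:R + 1) by rewrite divr_gt0.
    apply: filterS (near_dist t _ e1) => n; rewrite ltr_pdivlMr// => h1.
    apply: le_lt_trans (hlip m _ _) _.
    by have := mdist_ge0 (phi t) (f t n); lra.
  have cl : (h m (f t n) - m%:R * (t' - t + n.+1%:R^-1)) * (t' - t - n.+1%:R^-1)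
     @[n --> U] --> (h m (phi t) - m%:R * (t' - t + 0)) * (t' - t - 0).
    apply: cvgM; last by apply: cvgB => //; exact: cvg_cst.
    apply: cvgB => //; apply: cvgM; first exact: cvg_cst.
    by apply: cvgD => //; exact: cvg_cst.
  have cr : C t' n - C t n @[n --> U] --> c t' - c t.
    by apply: cvgB; [case: (Hc t')|case: (Hc t)].
  rewrite addr0 subr0 in cl; apply: (ler_cvg_to cl cr).
  have e1 : \forall n \near U, n.+1%:R^-1 < t' - t.
    have /cvgrPdist_lt/(_ _ lt) := delta_cvg; apply: filterS => n.
    by rewrite sub0r normrN gtr0_norm.
  have e2 : \forall n \near U, (maxn m (Num.truncn (t' + r)).+1 <= n)%N.
    by apply: ev; exact: nbhs_infty_ge.
  apply: filterS (filterI e1 e2) => n [h1]; rewrite geq_max => /andP[mn tn].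
  have h2 : t' <= chain_length (x_ n) (s_ n).
    have := long n; have : t' + r <= n%:R; last by lra.
    by apply/ltW; apply: lt_le_trans (truncnS_gt _) _; rewrite ler_nat.
  have t'0 : 0 <= t' := le_trans t0 tt'.
  rewrite /C /f !max_r//.
  by apply: walk_cost_increment => //; [move=> y; exact: hnd|exact: ltW].
Qed.
End limit_curve.

(** * Hyperbolicity from fast volume growth *)

Section escape.
Context {R : realType} {X : pmetricType R}.
Context (h : nat -> X -> R) (h0 : forall m x, 0 <= h m x).
Context (hlip : forall m x y, `|h m x - h m y| <= m%:R * mdist x y).
Context (hnd : forall x, {homo h ^~ x : m n / (m <= n)%N >-> m <= n}).
Context (b : X) (kappa : R) (phi : R -> X) (c : R -> R).
Context (low : forall n : nat, exists2 e, 0 < e &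
  forall x, mdist b x < n%:R -> e <= h 1%N x).
Context (phi_lip : forall t t', t <= t' -> mdist (phi t) (phi t') <= t' - t).
Context (c_bnd : forall t, 0 <= c t <= kappa).
Context (c_inc : forall m t t', 0 <= t -> t <= t' ->
    (h m (phi t) - m%:R * (t' - t)) * (t' - t) <= c t' - c t).

Let phi_continuous : continuous phi.
Proof.
move=> s; apply/metricType_numDomainType.cvgrPdist_lt => e e0; exists e => //= s' ss'.
apply: le_lt_trans ss'; case: (leP s s') => hs.
  by rewrite distrC ger0_norm ?subr_ge0// phi_lip.
by rewrite metric_sym gtr0_norm ?subr_gt0// phi_lip// ltW.
Qed.

Lemma lipschitz_rectifiable t t' : t <= t' -> rectifiable phi t t'.
Proof.
move=> tt'; split => //; first exact: continuous_subspaceT.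
by apply: le_lt_trans (lipschitz_length tt' phi_lip) _; rewrite ltry.
Qed.

Lemma lipschitz_locally_rectifiable : locally_rectifiable `[0, +oo[ phi.
Proof.
split; first exact: continuous_subspaceT.
by move=> t t' _ _; exact: lipschitz_rectifiable.
Qed.

Let c_nd t t' : 0 <= t -> t <= t' -> c t <= c t'.
Proof.
move=> t0 tt'; rewrite -subr_ge0; apply: le_trans (c_inc 0%N t0 tt').
by rewrite mul0r subr0 mulr_ge0// subr_ge0.
Qed.

(** Each visit to a bounded set costs a fixed amount, while the total cost is
    bounded. *)
Lemma escape (n : nat) : exists2 T : R, 0 < T &
  forall s, T <= s -> ~ ball b n%:R (phi s).
Proof.
have [e e0 He] := low n.
apply: contrapT => H.
have visit T : 0 < T -> exists2 s, T <= s & ball b n%:R (phi s).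
  move=> T0; apply: contrapT => H'; apply: H; exists T => // s Ts bs.
  by apply: H'; exists s.
pose eta := e / 2 * (e / 2).
have eta0 : 0 < eta by rewrite mulr_gt0// divr_gt0.
have big k : exists2 t, 0 <= t & k%:R * eta <= c t.
  elim: k => [|k [t t0 ht]]; first by exists 0; rewrite ?mul0r//; case/andP: (c_bnd 0).
  have t1 : 0 < t + 1 by lra.
  have [s ts bs] := visit _ t1.
  have s0 : 0 <= s by lra.
  exists (s + e / 2); first by lra.
  have ss : s <= s + e / 2 by lra.
  (* Over a time [e / 2], the 1-Lipschitz function [h 1] stays above [e / 2]. *)
  have es1 : s + e / 2 - s = e / 2 by lra.
  have := c_inc 1%N s0 ss; rewrite es1 mulr1n mul1r => inc.
  have es : e <= h 1%N (phi s) by apply: He; move: bs; rewrite ballEmdist.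
  have cs : c t <= c s by apply: c_nd => //; lra.
  have : eta <= (h 1%N (phi s) - e / 2) * (e / 2).
    by rewrite ler_wpM2r//; lra.
  have : k.+1%:R * eta = k%:R * eta + eta by rewrite -(@natr1 R k); ring.
  lra.
have [t _] := big (Num.truncn (kappa / eta)).+1.
apply/negP; rewrite -ltNge; apply: (@le_lt_trans _ _ kappa).
  by case/andP: (c_bnd t).
by rewrite -ltr_pdivrMr// truncnS_gt.
Qed.

Lemma limit_curve_integral (g : X -> \bar R) : nonneg_borel g ->
  (forall x, g x <= ereal_sup (range (fun m => (h m x)%:E)))%E ->
  (curve_integral g `[0%R, +oo[%R phi <= kappa%:E)%E.
Proof.
move=> bg gsup; apply: ge_ereal_sup => _ [[t t'] /= [tI t'I tt'] <-].
have t0 : 0 <= t by move: tI; rewrite in_itv/= andbT.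
have rect := lipschitz_rectifiable tt'.
apply: (line_integral_le_sup rect (G := h)) => // m.
  exact: lipschitz_nonneg_borel (ler0n _ m) (hlip m) (h0 m).
apply: (@le_trans _ _ (c t' - c t)%:E).
  apply: (line_integral_le_lipschitz_curve rect (h0 m) (ler0n _ m) (hlip m)) => //.
  by move=> s s' ts ss' s't'; apply: c_inc => //; exact: le_trans ts.
by have /andP[_ h1] := c_bnd t'; have /andP[h2 _] := c_bnd t; rewrite lee_fin; lra.
Qed.
End escape.

Section fast_growth.
Context {R : realType} {X : pmetricType R}.
Context (mu : {measure set (borel X) -> \bar R}) (b : X) (p : R).
Context (Cmu Cp lambda : R) (Cp0 : 0 < Cp) (lambda1 : 1 <= lambda) (p_gt1 : 1 < p).
Context (complete : complete_space X).
Context (dbl : doubling_with mu Cmu) (Cmu1 : 1 <= Cmu).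
Context (poin : poincare_with mu p Cp lambda).
Context (r0 c q : R) (r0_gt0 : 0 < r0) (c_gt0 : 0 < c) (p_lt_q : p < q).
Context (growth : forall r, r0 <= r -> c * r `^ q <= vol mu b r).

Let p_gt0 : 0 < p. Proof. exact: lt_trans p_gt1. Qed.

Let B := Cmu * Cp * r0 `^ (1 - q / p) / (1 - 2 `^ (1 - q / p)).
(* With this energy, the bound of [mean_le_energy] is 1 / 4. *)
Let A := c * (4 * B)^-1 `^ p.

Let B_gt0 : 0 < B.
Proof.
have s1 : 0 < q / p - 1 by rewrite subr_gt0 ltr_pdivlMr// mul1r.
have t1 : (2 : R) `^ (1 - q / p) < 1.
  rewrite -opprB powRN invf_lt1 ?powR_gt0//.
  have := @gt0_ltr_powR _ _ s1 1 2; rewrite powR1; apply; rewrite ?nnegrE//.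
  by rewrite ltr1n.
rewrite divr_gt0 ?subr_gt0// !mulr_gt0// ?powR_gt0//.
exact: lt_le_trans Cmu1.
Qed.

Let A_gt0 : 0 < A.
Proof. by rewrite mulr_gt0// powR_gt0// invr_gt0 mulr_gt0. Qed.

Let mean_lt (u g : X -> R) (rho : R) : (forall x, 0 <= u x <= 1) ->
  measurable_fun setT (EFin \o u : borel X -> \bar R) ->
  upper_gradient (EFin \o u) (EFin \o g) ->
  (\int[mu]_x ((EFin \o g) x `^ p) <= A%:E)%E -> 0 < rho ->
  (forall x, ~ ball b rho x -> u x = 0) -> mean mu b u r0 < 2^-1.
Proof.
move=> u01 mu_u ug intg rho0 u_out.
have := mean_le_energy Cp0 lambda1 p_gt1 dbl Cmu1 poin r0_gt0 c_gt0 p_lt_q growth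
  u01 mu_u ug intg rho0 u_out.
move=> /le_lt_trans; apply; rewrite -/B.
have -> : A / c = (4 * B)^-1 `^ p by rewrite /A mulrAC divff ?mul1r// gt_eqF.
rewrite -powRrM mulfV ?gt_eqF// powRr1; last by rewrite invr_ge0 mulr_ge0// ltW.
rewrite invfM mulrCA divff ?gt_eqF// mulr1; lra.
Qed.

Let small_point (u : X -> R) : (forall x, 0 <= u x <= 1) ->
  measurable_fun setT (EFin \o u : borel X -> \bar R) ->
  mean mu b u r0 < 2^-1 -> exists2 x, mdist b x < r0 & u x < 2^-1.
Proof.
move=> u01 mu_u; apply: contraPP => H; apply/negP; rewrite -leNgt.
have H' x : ball b r0 x -> 2^-1 <= u x.
  rewrite ballEmdist /= => xb; rewrite leNgt; apply/negP => ux.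
  by apply: H; exists x.
have v0 := vol_gt0 b dbl Cmu1 r0_gt0.
rewrite -(@ler_pM2r _ (vol mu b r0))// -lee_fin -(int_meanE b dbl Cmu1 u01 mu_u)//.
rewrite EFinM -(volE b dbl Cmu1)// -integral_cst; last exact: ball_borel.
apply: ge0_le_integral.
- exact: ball_borel.
- by move=> x _; rewrite lee_fin invr_ge0.
- exact: measurable_cst.
- exact: measurable_funTS mu_u.
- by move=> x /H'; rewrite lee_fin.
Qed.

(** If a weight has energy below [A / 2], its Lipschitz minorants have energy at
    most [A], so that at every scale some chain of cost below one half goes far
    out; the limit curve of these chains contradicts admissibility. *)
Lemma hyperbolic_of_fast_growth : hyperbolic mu p.
Proof.
exists b, r0; split => //.
have A20 : 0 < A / 2 by rewrite divr_gt0.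
apply: (@lt_le_trans _ _ (A / 2)%:E); first by rewrite lte_fin.
apply: le_ereal_inf_tmp => _ [g [bg adm] <-]; rewrite leNgt; apply/negP => gA.
have mufin (n : nat) : (mu (ball b n%:R) < +oo)%E.
  have := ball_gt0_fin dbl Cmu1 b (ltr0Sn R n) => /andP[_]; apply: le_lt_trans.
  apply: le_measure; rewrite ?inE; [exact: ball_borel..|].
  by apply: le_ball; rewrite ler_nat.
have [h [h01 hlip hsup hint low]] := lipschitz_minorants mufin p_gt0 bg A20.
have h0 m x : 0 <= h m x by case: (h01 m x).
have hM m x : h m x <= m%:R by case: (h01 m x).
have hnd x : {homo h ^~ x : m n / (m <= n)%N >-> m <= n} by case: (hsup x).
have chains k : exists xs : X * seq X, [/\ mdist b xs.1 < r0,
    chain k.+1%:R^-1 xs.1 xs.2, chain_cost (h k) xs.1 xs.2 < 2^-1 &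
    k%:R <= mdist b (last xs.1 xs.2)].
  pose d : R := k.+1%:R^-1; have d0 : 0 < d by rewrite invr_gt0 ltr0n.
  pose rho : R := k.+1%:R; have rho0 : 0 < rho by rewrite ltr0n.
  pose u := chain_potential (h k) (~` ball b rho) d.
  have u01 x : 0 <= u x <= 1.
    by rewrite chain_potential_ge0 ?chain_potential_le1.
  have mu_u : measurable_fun setT (EFin \o u : borel X -> \bar R).
    by apply: (@chain_potential_borel _ _ _ _ _ (h0 k) k%:R) => //; exact: hM.
  have bh : nonneg_borel (EFin \o h k).
    exact: lipschitz_nonneg_borel (ler0n _ k) (hlip k) (h0 k).
  have ug : upper_gradient (EFin \o u) (EFin \o h k).
    split => // gamma s t rect _.
    apply: (local_upper_gradient rect (h0 k) (ler0n _ k) (hlip k) d0).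
    by move=> x y; apply: chain_potential_grad => //; exact: ler0n.
  have intA : (\int[mu]_x ((EFin \o h k) x `^ p) <= A%:E)%E.
    have -> : A%:E = ((A / 2)%:E + (A / 2)%:E)%E by rewrite -EFinD -splitr.
    by apply: le_trans (hint k) _; apply: leeD2r; exact: ltW.
  have u_out x : ~ ball b rho x -> u x = 0 by exact: chain_potential_target.
  have [x bx ux] := small_point u01 mu_u (mean_lt u01 mu_u ug intA rho0 u_out).
  have half1 : 2^-1 <= 1 :> R by rewrite invf_le1// ler1n.
  have [s [cs Es cost]] := chain_potential_lt ux half1.
  exists (x, s); split => //=; move: Es; rewrite /= ballEmdist/= => /negP.
  by rewrite -leNgt; apply: le_trans; rewrite ler_nat.
have /choice[xs Hxs] := chains.
have [||||phi [c' [plip pcl cb cinc]]] := @limit_curve R X mu Cmu dbl Cmu1 complete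
  h h0 hlip hnd b r0 r0_gt0 2^-1 (fun k => (xs k).1) (fun k => (xs k).2).
- by move=> k; case: (Hxs k).
- by move=> k; case: (Hxs k).
- by move=> k; case: (Hxs k).
- by move=> k; case: (Hxs k).
have gsup x : (g x <= ereal_sup (range (fun m => (h m x)%:E)))%E by case: (hsup x).
have := limit_curve_integral h0 hlip hnd plip cb cinc bg gsup.
apply/negP; rewrite -ltNge; apply: (@lt_le_trans _ _ 1%E).
  by rewrite lte_fin invf_lt1// ltr1n.
apply: adm; last exact: lipschitz_locally_rectifiable.
split => //=; first exact: lipschitz_locally_rectifiable.
move=> n; have [N HN] : exists N : nat, n%:R * r0 <= N%:R.
  by exists (Num.truncn (n%:R * r0)).+1; exact/ltW/truncnS_gt.
have [T T0 HT] := escape h0 low cb cinc N.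
exists T => // s /HT bs bs'; apply: bs; exact: le_ball bs'.
Qed.
End fast_growth.

Section liminf.
Context {R : realType} {X : pmetricType R}.
Context (mu : {measure set (borel X) -> \bar R}) (b : X) (q : R).
Local Open Scope ereal_scope.

Lemma liminf_growth_lty : liminf_growth mu b q < +oo ->
  exists2 M : R, (0 <= M)%R & forall rho : R, exists r : R, (rho <= r)%R /\
    mu (ball b r) <= (M * r `^ q)%:E.
Proof.
rewrite /liminf_growth limf_einfE; set f := fun r : R => _.
set S := ereal_sup _ => Soo.
have [M M0 SM] : exists2 M : R, (0 <= M)%R & S < M%:E.
  move: Soo; case: S => [s _|//|_]; last by exists 0%R => //; exact: ltNyr.
  exists (Num.max 0 s + 1)%R; first by rewrite addr_ge0// le_max lexx.
  rewrite lte_fin; have : (s <= Num.max 0 s)%R by rewrite le_max lexx orbT.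
  by lra.
exists M => // rho; pose V : set R := [set r | (Num.max rho 0 < r)%R].
have VF : pinfty_nbhs R V by exists (Num.max rho 0)%R; split => //; exact: num_real.
have : ereal_inf (f @` V) < M%:E.
  by apply: le_lt_trans SM; apply: ereal_sup_ubound; exists V.
move=> /ereal_inf_lt[_ [r Vr <-] fr]; exists r.
move: Vr; rewrite /V /= gt_max => /andP[rr rp]; split; first exact: ltW.
have rq : (0 < r `^ q)%R by rewrite powR_gt0.
rewrite [(M * _)%R]mulrC EFinM -lee_pdivrMl// muleC; exact: ltW.
Qed.

Lemma liminf_growth_gt0 : 0 < liminf_growth mu b q ->
  exists c r0 : R, [/\ (0 < c)%R, (0 < r0)%R &
    forall r, (r0 <= r)%R -> (c * r `^ q)%:E <= mu (ball b r)].
Proof.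
rewrite /liminf_growth limf_einfE => /ereal_sup_gt [_ [V [M [_ MV]] <-]].
set f := fun r : R => _; set I := ereal_inf _ => I0.
have [c c0 cI] : exists2 c : R, (0 < c)%R & c%:E <= I.
  move: I0; case: I => [i i0|_|//]; first by exists i.
  by exists 1%R => //; exact: leey.
exists c, (Num.max M 0 + 1)%R; split => //.
  by rewrite ltr_wpDl// le_max lexx orbT.
move=> r rr; have r1 : (Num.max M 0 < r)%R by apply: lt_le_trans rr; rewrite ltrDl.
move: r1; rewrite gt_max => /andP[Mr rp].
have rq : (0 < r `^ q)%R by rewrite powR_gt0.
rewrite mulrC EFinM -lee_pdivlMl//.
apply: le_trans cI _; rewrite muleC; apply: ereal_inf_lbound; exists r => //.
exact: MV.
Qed.
End liminf.

Theorem theorem1p2 (R : realType) (p : R) (X : pmetricType R)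
  (mu : {measure set (borel X) -> \bar R})
  (Omega : set X) (nu : {measure set (borel X) -> \bar R}) (theta : R) (b : X)
  (p_gt1 : 1 < p)
  (X_unbounded : unbounded [set: X])
  (X_complete : complete_space X)
  (mu_doubling : doubling mu)
  (mu_poincare : poincare mu p)
  (Omega_unbounded : unbounded Omega)
  (Omega_uniform : uniform_domain Omega)
  (Omega_dense : closure Omega = [set: X])
  (bdry_unbounded : unbounded (~` Omega))
  (bdry_perfect : uniformly_perfect (~` Omega))
  (nu_radon : radon_on (~` Omega) nu)
  (theta_gt0 : 0 < theta) (theta_ltp : theta < p)
  (nu_codim : codimensional mu nu (~` Omega) theta)
  (b_bdry : (~` Omega) b) :
  ((liminf_growth mu b p < +oo)%E -> parabolic mu p) /\
  ((exists2 q0 : R, p < q0 & (0 < liminf_growth mu b q0)%E) ->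
     hyperbolic mu p).
Proof.
split.
  move=> /liminf_growth_lty[M M0 HM].
  exact: (parabolic_of_slow_growth p_gt1 M0 HM).
move=> [q pq /liminf_growth_gt0[c [r0 [c0 r00 growth]]]].
have [Cmu Cmu1 dbl] := mu_doubling.
have [Cp [lambda [Cp0 lambda1 poin]]] := mu_poincare.
apply: (hyperbolic_of_fast_growth (b := b) Cp0 lambda1 p_gt1 X_complete dbl Cmu1
  poin r00 c0 pq) => r rr.
rewrite -lee_fin -(volE b dbl Cmu1) ?growth//.
exact: lt_le_trans rr.
Qed.
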